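(* There exist a real number $\alpha$ and a sequence $(P_i)_{i\ge1}$ of finite $3$-graphs such that $\lambda(P_1)>\lambda(P_2)>\cdots$, $\lambda(P_i)>\alpha$ for all $i$, $\lambda(P_i)\to\alpha$, and $$\frac{\lambda(P_i)-\alpha}{\lambda(P_{i+1})-\alpha}\to 1\quad\text{as } i\to\infty.$$
   Context: For a finite $3$-graph $G$ (a set of $3$-element subsets of a finite vertex set $V(G)$), its Lagrangian polynomial is $P_G(\mathbf y)=3!\sum_{e\in G}\prod_{v\in e}y_v$ for $\mathbf y\in\mathbb R^{V(G)}$, and its Lagrangian is $\lambda(G)=\max\{P_G(\mathbf y): \mathbf y\in\mathbb R_{\ge0}^{V(G)},\ \sum_v y_v=1\}$. *)

(* Defs.v *)
From HB Require Import structures.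
From mathcomp Require Import all_boot all_order all_algebra.
From mathcomp Require Import all_classical all_reals.
From mathcomp Require Import topology normedtype derive.

Set Implicit Arguments.
Unset Strict Implicit.
Unset Printing Implicit Defensive.

Import Order.TTheory GRing.Theory Num.Theory.
Import numFieldNormedType.Exports.

Local Open Scope classical_set_scope.
Local Open Scope ring_scope.

Record graph3 : Type := Graph3 {
  vertices : finType;
  edges : {set {set vertices}};
  edges_card3 : forall e, e \in edges -> #|e| = 3 }.

Section Lagrangian.
Variables (R : realType) (G : graph3).

Definition lagrangian_poly (y : vertices G -> R) : R :=
  (3`!)%:R * \sum_(e in edges G) \prod_(v in e) y v.

Definition simplex : set (vertices G -> R) :=
  [set y | (forall v, 0 <= y v) /\ \sum_v y v = 1].

(* By lagrangian_max below, the supremum is a maximum as soon as the vertex set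
   is nonempty; otherwise the simplex is empty and lagrangian is sup set0 = 0. *)
Definition lagrangian : R := sup (lagrangian_poly @` simplex).

Let coord_continuous (v : vertices G) :
  continuous (fun y : {ptws vertices G -> R} => y v : R).
Proof. exact: (@proj_continuous (vertices G) (fun=> R) v). Qed.

Let sum_continuous (T : topologicalType) (I : Type) (r : seq I) (P : pred I)
    (F : I -> T -> R) :
  (forall i, P i -> continuous (F i)) ->
  continuous (fun x => \sum_(i <- r | P i) F i x).
Proof. by apply: continuous_big; exact: add_continuous. Qed.

Let prod_continuous (T : topologicalType) (I : Type) (r : seq I) (P : pred I)
    (F : I -> T -> R) :
  (forall i, P i -> continuous (F i)) ->
  continuous (fun x => \prod_(i <- r | P i) F i x).
Proof. by apply: continuous_big; exact: mul_continuous. Qed.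

Let scale_continuous (T : topologicalType) (c : R) (f : T -> R) :
  continuous f -> continuous (fun x => c * f x).
Proof. by move=> cf x; exact: cvgM (cvg_cst c) (cf x). Qed.

Let poly_continuous :
  continuous (lagrangian_poly : {ptws vertices G -> R} -> R).
Proof.
apply: scale_continuous; apply: sum_continuous => e _.
by apply: prod_continuous => v _; exact: coord_continuous.
Qed.

Let simplex_compact : compact (simplex : set {ptws vertices G -> R}).
Proof.
apply: (@subclosed_compact _ _
  [set f : {ptws vertices G -> R} | forall v, `[0, 1]%classic (f v)]).
- have -> : simplex =
      (\bigcap_v ((fun y : {ptws vertices G -> R} => y v) @^-1` [set x | 0 <= x]))
      `&` (fun y : {ptws vertices G -> R} => \sum_v y v) @^-1` [set 1].
    by apply/seteqP; split=> y [y0 y1]; split=> // v; [move=> _|]; exact: y0.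
  apply: closedI.
    apply: closed_bigI => v _; apply: preimage_closed; last exact: closed_ge.
    by move=> y _; exact: coord_continuous.
  apply: preimage_closed; last exact: closed_eq.
  by move=> y _; apply: sum_continuous => v _; exact: coord_continuous.
- apply: (@tychonoff (vertices G) (fun=> R) (fun=> `[0, 1]%classic)) => v.
  exact: segment_compact.
- move=> y [y0 y1] v /=; rewrite in_itv/= y0/= -y1 (bigD1 v)//= lerDl.
  by apply: sumr_ge0.
Qed.

Lemma lagrangian_max : (0 < #|vertices G|)%N ->
  exists2 y, simplex y & lagrangian = lagrangian_poly y /\
    forall z, simplex z -> lagrangian_poly z <= lagrangian_poly y.
Proof.
case/card_gt0P => v0 _.
have s0 : simplex !=set0.
  exists (fun v => (v == v0)%:R); split => [v|]; first exact: ler0n.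
  rewrite (bigD1 v0)//= eqxx big1 ?addr0// => v /negbTE -> //.
have [|y /set_mem sy ymax] := @compact_EVT_max {ptws vertices G -> R} R
  lagrangian_poly simplex s0 simplex_compact.
- by apply: continuous_subspaceT; exact: poly_continuous.
have ub z : simplex z -> lagrangian_poly z <= lagrangian_poly y.
  by move=> sz; apply: ymax; exact: mem_set.
exists y => //; split => //; apply/eqP; rewrite eq_le; apply/andP; split.
  by apply: ge_sup => [|_ [z sz <-]]; [exact: image_nonempty|exact: ub].
apply: ub_le_sup; last by exists y.
by exists (lagrangian_poly y) => _ [z sz <-]; exact: ub.
Qed.

End Lagrangian.

Arguments lagrangian R G : clear implicits.

(* Main.v *)
(** The 3-graph P_n consists of 2m vertices w_(k,0), w_(k,1) (k < m), one vertex v and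
    t vertices carrying a d-regular bipartite expander E with second eigenvalue sigma.
    Its edges are all triples except {w_(k,0), w_(k,1), b}, {b, b', b''} and the
    {v, b, b'} with bb' not in E, where b, b', b'' are vertices of E.
    For weights W, v, x of the three groups, each uniformly spread, P equals
    H(x, v) + 3 (d v - W) x^2 / t with H independent of n: the loss comes from the pairs
    bb missing in the link of the w's, the gain from the edges of E.  The spectral gap
    shows that when sigma v <= W no other distribution over the vertices of E is better;
    when sigma v > W, P is at most alpha := max H for 72 sigma <= 2m.  If moreover
    4m < d, the gain beats the loss at the maximum of H.
    So lambda(P_n) = max_z (H(z) + g(z) / t_n), a convex function of 1/t_n with positive
    slope at 0, whence lambda(P_n) - alpha ~ c / t_n, and t_n = a (n + 2)^2.

    The expanders come from the action of the translations and of the shears on (Z/n)^2: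
    in Fourier space an almost invariant mean zero function would be concentrated near 0
    and almost invariant under SL_2(Z) there, which ping-pong forbids.  Words in these
    maps make d / sigma as large as needed; a product with the point-line incidences of a
    finite affine plane, in which each word gets its own parallel translate, removes the
    multiple edges. *)

Require Import Defs.
From HB Require Import structures.
From mathcomp Require Import all_boot all_order all_algebra.
From mathcomp Require Import all_classical all_reals.
From mathcomp Require Import topology normedtype sequences derive trigo.
From mathcomp Require Import zify ring lra.

Set Implicit Arguments.
Unset Strict Implicit.
Unset Printing Implicit Defensive.

Import Order.TTheory GRing.Theory Num.Theory.
Import numFieldNormedType.Exports.

Local Open Scope classical_set_scope.
Local Open Scope ring_scope.

(** * Spectral gap on the discrete torus *)

Section TorusFourier.
Variables (R : realType) (k : nat).
Notation Zn := 'I_k.+2.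
Notation torus := (Zn * Zn)%type.

Let theta : R := pi *+ 2 / k.+2%:R.

(** Real and imaginary parts of the character exp(2 pi i a / n) with n = k + 2, so that all Fourier
    analysis stays over the reals. Writing n as [k.+2] makes the ordinals a nontrivial ring. *)
Definition chi_cos (a : Zn) : R := cos (a%:R * theta).
Definition chi_sin (a : Zn) : R := sin (a%:R * theta).

Let nR0 : k.+2%:R != 0 :> R. Proof. by rewrite pnatr_eq0. Qed.

Let trig_mod (m : nat) :
  cos ((m %% k.+2)%N%:R * theta) = cos (m%:R * theta) /\
  sin ((m %% k.+2)%N%:R * theta) = sin (m%:R * theta).
Proof.
have -> : m%:R * theta = (m %% k.+2)%N%:R * theta + (pi *+ 2) *+ (m %/ k.+2).
  rewrite {1}(divn_eq m k.+2) natrD natrM /theta -mulr_natr.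
  by move: nR0; move: (k.+2%:R : R) => y y0; field.
by split; rewrite (periodicn (@cosD2pi R), periodicn (@sinD2pi R)).
Qed.

Lemma chi_cosD a b :
  chi_cos (a + b) = chi_cos a * chi_cos b - chi_sin a * chi_sin b.
Proof. by rewrite /chi_cos /= (trig_mod _).1 natrD mulrDl cosD. Qed.

Lemma chi_sinD a b :
  chi_sin (a + b) = chi_sin a * chi_cos b + chi_cos a * chi_sin b.
Proof. by rewrite /chi_sin /= (trig_mod _).2 natrD mulrDl sinD. Qed.

Lemma chi_cos0 : chi_cos 0 = 1.
Proof. by rewrite /chi_cos mul0r cos0. Qed.

Lemma chi_sin0 : chi_sin 0 = 0.
Proof. by rewrite /chi_sin mul0r sin0. Qed.

Lemma chi_sqr a : chi_cos a ^+ 2 + chi_sin a ^+ 2 = 1.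
Proof. exact: cos2Dsin2. Qed.

(** The addition formulas at [- a + a = 0] form a linear system for the two values at [- a], of
    determinant 1 by [chi_sqr]; the proof combines these equations as Cramer's rule would. *)
Lemma chi_cosN a : chi_cos (- a) = chi_cos a.
Proof.
have := chi_cosD (- a) a; have := chi_sinD (- a) a; rewrite addNr chi_cos0 chi_sin0.
move=> e1 e2; have e3 := chi_sqr a.
move: e1 e2 e3; move: (chi_cos (- a)) (chi_sin (- a)) (chi_cos a) (chi_sin a).
move=> c' s' c s e1 e2 e3; apply/eqP; rewrite -subr_eq0; apply/eqP.
transitivity (c' * (1 - (c ^+ 2 + s ^+ 2)) - c * (1 - (c' * c - s' * s))
  + s * (s' * c + c' * s)); first by ring.
by rewrite -e1 -e2 e3; ring.
Qed.

Lemma chi_sinN a : chi_sin (- a) = - chi_sin a.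
Proof.
have := chi_cosD (- a) a; have := chi_sinD (- a) a; rewrite addNr chi_cos0 chi_sin0.
move=> e1 e2; have e3 := chi_sqr a.
move: e1 e2 e3; move: (chi_cos (- a)) (chi_sin (- a)) (chi_cos a) (chi_sin a).
move=> c' s' c s e1 e2 e3; apply/eqP; rewrite -subr_eq0; apply/eqP.
transitivity (s' * (1 - (c ^+ 2 + s ^+ 2)) + s * (1 - (c' * c - s' * s))
  + c * (s' * c + c' * s)); first by ring.
by rewrite -e1 -e2 e3; ring.
Qed.

Let theta_gt0 : 0 < theta.
Proof. by rewrite divr_gt0 ?ltr0n// mulrn_wgt0// pi_gt0. Qed.

Lemma chi_cos_lt1 (a : Zn) : a != 0 -> chi_cos a < 1.
Proof.
move=> a0; rewrite /chi_cos.
(* Half the angle lies strictly between 0 and pi, where the sine is positive; then cos(2t) = 1 - 2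
   sin(t)^2 is below 1. *)
have -> : a%:R * theta = (a%:R * theta / 2) *+ 2 by rewrite -mulr_natr; field.
have : 0 < sin (a%:R * theta / 2).
  have t0 : 0 < a%:R * theta by apply: mulr_gt0 => //; rewrite ltr0n lt0n.
  apply: sin_gt0_pi; rewrite (divr_gt0 t0 _)//=.
  have -> : a%:R * theta / 2 = a%:R / k.+2%:R * pi.
    by rewrite /theta -mulr_natr; move: nR0; move: (k.+2%:R : R) => y y0; field.
  by rewrite gtr_pMl ?pi_gt0// ltr_pdivrMr ?ltr0n// mul1r ltr_nat ltn_ord.
rewrite cos_mulr2n; have := cos2Dsin2 (a%:R * theta / 2).
by move: (sin _) (cos _) => s c; rewrite -mulr_natr; nra.
Qed.

Lemma chi_cos_le0 (a : Zn) : (k.+2 <= 4 * a <= 3 * k.+2)%N -> chi_cos a <= 0.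
Proof.
case/andP => a1 a3; rewrite /chi_cos.
have p0 := @pi_gt0 R.
rewrite -oppr_ge0.
have -> : - cos (a%:R * theta) = cos (a%:R * theta - pi).
  by rewrite cosB cospi sinpi; ring.
have n0 : (0 : R) < k.+2%:R by rewrite ltr0n.
have h1 : (k.+2%:R : R) <= 4 * a%:R by rewrite -natrM ler_nat.
have h3 : 4 * a%:R <= 3 * k.+2%:R :> R by rewrite -!natrM ler_nat.
have -> : a%:R * theta - pi = (4 * a%:R - 2 * k.+2%:R) / k.+2%:R * (pi / 2).
  by rewrite /theta -mulr_natr; move: nR0; move: (k.+2%:R : R) => y y0; field.
have l1 : -1 <= (4 * a%:R - 2 * k.+2%:R) / k.+2%:R :> R.
  by rewrite (ler_pdivlMr _ _ n0); lra.
have l2 : (4 * a%:R - 2 * k.+2%:R) / k.+2%:R <= 1 :> R.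
  by rewrite (ler_pdivrMr _ _ n0); lra.
apply: cos_ge0_pihalf.
by move: (_ / _) l1 l2 => y l1 l2; apply/andP; split; nra.
Qed.

Definition dot (z w : torus) : Zn := z.1 * w.1 + z.2 * w.2.

Definition dft_cos (f : torus -> R) z := \sum_w f w * chi_cos (dot z w).
Definition dft_sin (f : torus -> R) z := \sum_w f w * chi_sin (dot z w).
Definition power (f : torus -> R) z := dft_cos f z ^+ 2 + dft_sin f z ^+ 2.

Let chi_sum (a : torus) :
  \sum_z chi_cos (dot z a) = if a == 0 then k.+2%:R ^+ 2 else 0.
Proof.
have [->|a0] := eqVneq a 0.
  rewrite (eq_bigr (fun=> 1)) => [|z _]; last by rewrite /dot !mulr0 addr0 chi_cos0.
  by rewrite sumr_const card_prod card_ord -mulr_natr mul1r natrM expr2.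
have [z0 z0a] : exists z0, dot z0 a != 0.
  move: a0; rewrite -pair_eqE negb_and /=; case/orP => h.
    by exists (1, 0); rewrite /dot /= mul1r mul0r addr0.
  by exists (0, 1); rewrite /dot /= mul1r mul0r add0r.
have dD z : dot (z + z0) a = dot z a + dot z0 a.
  by rewrite /dot /=; ring.
(* Translating the summation variable by [z0] multiplies s + i r by a character value c + i d other
   than 1, so the sum vanishes. In real form, this is [s * ((1 - c) ^+ 2 + d ^+ 2) = 0]. *)
set s := LHS; pose r := \sum_z chi_sin (dot z a).
have e1 : s = s * chi_cos (dot z0 a) - r * chi_sin (dot z0 a).
  rewrite {1}/s (reindex_inj (addIr z0)) !mulr_suml -sumrB.
  by apply: eq_bigr => z _; rewrite dD chi_cosD.
have e2 : r = r * chi_cos (dot z0 a) + s * chi_sin (dot z0 a).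
  rewrite {1}/r (reindex_inj (addIr z0)) !mulr_suml -big_split.
  by apply: eq_bigr => z _; rewrite dD chi_sinD.
have := chi_cos_lt1 z0a; have := chi_sqr (dot z0 a).
move: e1 e2; move: (chi_cos _) (chi_sin _) => c d e1 e2 e3 c1.
have : s * ((1 - c) ^+ 2 + d ^+ 2) = 0.
  transitivity ((1 - c) * (s * (1 - c)) + d * (s * d)); first by ring.
  have -> : s * (1 - c) = - (r * d) by lra.
  have -> : s * d = r * (1 - c) by lra.
  by ring.
move/eqP; rewrite mulf_eq0 => /orP[/eqP//|/eqP h].
have : 0 < (1 - c) ^+ 2 by rewrite exprn_gt0 // subr_gt0.
by have := sqr_ge0 d; lra.
Qed.

Lemma parseval f : \sum_z power f z = k.+2%:R ^+ 2 * \sum_w f w ^+ 2.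
Proof.
have pE z : power f z = \sum_w \sum_w' f w * f w' * chi_cos (dot z (w - w')).
  rewrite /power !expr2 /dft_cos /dft_sin !mulr_suml -big_split.
  apply: eq_bigr => w _; rewrite !mulr_sumr -big_split; apply: eq_bigr => w' _ /=.
  have -> : dot z (w - w') = dot z w + (- dot z w') by rewrite /dot /=; ring.
  by rewrite chi_cosD chi_cosN chi_sinN; ring.
under eq_bigr do rewrite pE.
rewrite exchange_big mulr_sumr; apply: eq_bigr => w _ /=.
rewrite exchange_big (bigD1 w)//= [X in _ + X]big1 => [|w' w'w].
  by rewrite addr0 -mulr_sumr chi_sum subrr eqxx; ring.
by rewrite -mulr_sumr chi_sum subr_eq0 eq_sym (negbTE w'w) mulr0.
Qed.

Lemma dft_cosB f g z : dft_cos (f \- g) z = dft_cos f z - dft_cos g z.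
Proof. by rewrite -sumrB; apply: eq_bigr => w _; rewrite mulrBl. Qed.

Lemma dft_sinB f g z : dft_sin (f \- g) z = dft_sin f z - dft_sin g z.
Proof. by rewrite -sumrB; apply: eq_bigr => w _; rewrite mulrBl. Qed.

(** A translation multiplies the transform by a unit character value, and the squared distance of
    that value from 1 is 2 - 2 cos. *)
Lemma power_shift f w0 z :
  power (f \- (fun w => f (w + w0))) z = power f z * (2 - 2 * chi_cos (dot z w0)).
Proof.
rewrite /power dft_cosB dft_sinB.
have -> : dft_cos (fun w => f (w + w0)) z =
    dft_cos f z * chi_cos (dot z w0) + dft_sin f z * chi_sin (dot z w0).
  rewrite /dft_cos (reindex_inj (addIr (- w0))) !mulr_suml -big_split.
  apply: eq_bigr => w _; rewrite /= subrK.
  have -> : dot z (w - w0) = dot z w + (- dot z w0) by rewrite /dot /=; ring.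
  by rewrite chi_cosD chi_cosN chi_sinN; ring.
have -> : dft_sin (fun w => f (w + w0)) z =
    dft_sin f z * chi_cos (dot z w0) - dft_cos f z * chi_sin (dot z w0).
  rewrite /dft_sin (reindex_inj (addIr (- w0))) !mulr_suml -sumrB.
  apply: eq_bigr => w _; rewrite /= subrK.
  have -> : dot z (w - w0) = dot z w + (- dot z w0) by rewrite /dot /=; ring.
  by rewrite chi_sinD chi_cosN chi_sinN; ring.
have := chi_sqr (dot z w0).
move: (chi_cos _) (chi_sin _) (dft_cos _ _) (dft_sin _ _) => c s C S e.
transitivity ((C ^+ 2 + S ^+ 2) * (1 - 2 * c + (c ^+ 2 + s ^+ 2))); first by ring.
by rewrite e; ring.
Qed.

Definition shear1 (w : torus) : torus := (w.1 + w.2, w.2).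
Definition shear2 (w : torus) : torus := (w.1, w.2 + w.1).
Definition unshear1 (w : torus) : torus := (w.1 - w.2, w.2).
Definition unshear2 (w : torus) : torus := (w.1, w.2 - w.1).

Lemma shear1K : cancel shear1 unshear1.
Proof. by case=> u v; rewrite /unshear1 /= addrK. Qed.
Lemma unshear1K : cancel unshear1 shear1.
Proof. by case=> u v; rewrite /shear1 /= subrK. Qed.
Lemma shear2K : cancel shear2 unshear2.
Proof. by case=> u v; rewrite /unshear2 /= addrK. Qed.
Lemma unshear2K : cancel unshear2 shear2.
Proof. by case=> u v; rewrite /shear2 /= subrK. Qed.

(** Composition with a matrix acts on frequencies by its inverse transpose, which exchanges the two
    kinds of shears. *)
Lemma dft_shear1 f z :
  dft_cos (f \o shear1) z = dft_cos f (unshear2 z) /\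
  dft_sin (f \o shear1) z = dft_sin f (unshear2 z).
Proof.
have dotE w : dot z (unshear1 w) = dot (unshear2 z) w by rewrite /dot /=; ring.
by split; rewrite /dft_cos /dft_sin (reindex_inj (can_inj unshear1K));
  apply: eq_bigr => w _; rewrite /= unshear1K dotE.
Qed.

Lemma dft_shear2 f z :
  dft_cos (f \o shear2) z = dft_cos f (unshear1 z) /\
  dft_sin (f \o shear2) z = dft_sin f (unshear1 z).
Proof.
have dotE w : dot z (unshear2 w) = dot (unshear1 z) w by rewrite /dot /=; ring.
by split; rewrite /dft_cos /dft_sin (reindex_inj (can_inj unshear2K));
  apply: eq_bigr => w _; rewrite /= unshear2K dotE.
Qed.

End TorusFourier.

(** * Ping-pong in frequency space *)

Section PingPong.
Variables (R : realType) (k : nat).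
Notation Zn := 'I_k.+2.
Notation torus := (Zn * Zn)%type.

(** The representative in (-n/2, n/2]. On residues of absolute value below n/4 ([small]), sums and
    differences do not wrap around, so shears act there as on pairs of integers. *)
Definition signed_rep (u : Zn) : int :=
  if (2 * u <= k.+2)%N then u%:Z else u%:Z - k.+2%:Z.

Definition small (u : Zn) := 4 * `|signed_rep u| < k.+2%:Z.

Let val_add (u v : Zn) :
  val (u + v) = (if u + v < k.+2 then u + v else u + v - k.+2)%N.
Proof.
have := ltn_ord u; have := ltn_ord v => hv hu /=.
case: ltnP => h; first by rewrite modn_small.
by rewrite -{1}(subnK h) modnDr modn_small //; lia.
Qed.

Let val_opp (u : Zn) : val (- u) = (if u == 0%N :> nat then 0 else k.+2 - u)%N.
Proof.
have := ltn_ord u => hu /=; case: eqP => [->|h]; first by rewrite subn0 modnn.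
by rewrite modn_small //; lia.
Qed.

Lemma signed_repD (u v : Zn) : small u -> small v ->
  signed_rep (u + v) = signed_rep u + signed_rep v.
Proof.
have := ltn_ord u; have := ltn_ord v => hv hu.
rewrite /small /signed_rep; have := val_add u v; move: (u + v) => w /= ->.
by repeat case: ifP; lia.
Qed.

Lemma signed_repN (u : Zn) : small u -> signed_rep (- u) = - signed_rep u.
Proof.
have := ltn_ord u => hu.
rewrite /small /signed_rep; have := val_opp u; move: (- u) => w /= ->.
by repeat case: ifP; lia.
Qed.

Lemma smallN (u : Zn) : small u -> small (- u).
Proof. by move=> h; rewrite /small signed_repN// normrN. Qed.

Lemma signed_rep_eq0 (u : Zn) : signed_rep u = 0 -> u = 0.
Proof.
have := ltn_ord u => hu; rewrite /signed_rep => h.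
by apply/val_inj => /=; move: h; case: ifP; lia.
Qed.

Lemma chi_cos_not_small (u : Zn) : ~~ small u -> chi_cos R u <= 0.
Proof.
have := ltn_ord u => hu; rewrite /small /signed_rep => h.
by apply: chi_cos_le0; move: h; case: ifP; lia.
Qed.

Variable f : torus -> R.
Let p := power f.

Definition dft_gap (A : torus -> torus) z :=
  (dft_cos f z - dft_cos f (A z)) ^+ 2 + (dft_sin f z - dft_sin f (A z)) ^+ 2.

Let power_ge0 z : 0 <= p z.
Proof. by rewrite addr_ge0 ?sqr_ge0. Qed.

Let gap_ge0 A z : 0 <= dft_gap A z.
Proof. by rewrite addr_ge0 ?sqr_ge0. Qed.

(** This is (a + b)^2 <= (1 + e) a^2 + (1 + 1/e) b^2 with e = 1/2. The factor 3/2 must stay below 2: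
    in [ping_pong], two images of [K] share the mass of [K] once. *)
Let power_le A z : p z <= 3 / 2 * p (A z) + 3 * dft_gap A z.
Proof.
rewrite /p /power /dft_gap.
move: (dft_cos f z) (dft_cos f (A z)) (dft_sin f z) (dft_sin f (A z)).
move=> C C' S S'; have := sqr_ge0 (C' - 2 * (C - C')).
by have := sqr_ge0 (S' - 2 * (S - S')); lra.
Qed.

Let transfer (A : torus -> torus) (K K1 : pred torus) : injective A ->
  (forall z, K z -> K1 (A z)) ->
  \sum_(z | K z) p z <= 3 / 2 * (\sum_(z | K1 z) p z) + 3 * \sum_z dft_gap A z.
Proof.
move=> injA KK1.
apply: (@le_trans _ _ (\sum_(z | K z) (3 / 2 * p (A z) + 3 * dft_gap A z))).
  by apply: ler_sum => z _; exact: power_le.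
rewrite big_split /= -!mulr_sumr; apply: lerD; rewrite ler_pM2l ?divr_gt0//.
  rewrite [leRHS](reindex_inj injA) /= big_mkcond [leRHS]big_mkcond; apply: ler_sum => z _.
  by case: ifP => [/KK1 ->//|_]; case: ifP.
by rewrite big_mkcond; apply: ler_sum => z _; case: ifP.
Qed.

(* Ping-pong: A and B send K into disjoint parts of K, so a measure that both
   nearly preserve gives K little mass. *)
Lemma ping_pong (A B : torus -> torus) (K Q K1 K2 : pred torus) :
  injective A -> injective B ->
  (forall z, K z -> Q z -> K1 (A z)) -> (forall z, K z -> Q z -> K2 (B z)) ->
  (forall z, K1 z -> K z && ~~ K2 z) -> (forall z, K2 z -> K z) ->
  \sum_(z | K z) p z <= 4 * (\sum_(z | K z && ~~ Q z) p z)
    + 6 * (\sum_z dft_gap A z + \sum_z dft_gap B z).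
Proof.
move=> injA injB KA KB K12 K2K.
have hA : \sum_(z | K z && Q z) p z <=
    3 / 2 * (\sum_(z | K1 z) p z) + 3 * \sum_z dft_gap A z.
  by apply: transfer => // z /andP[]; exact: KA.
have hB : \sum_(z | K z && Q z) p z <=
    3 / 2 * (\sum_(z | K2 z) p z) + 3 * \sum_z dft_gap B z.
  by apply: transfer => // z /andP[]; exact: KB.
have h12 : \sum_(z | K1 z) p z + \sum_(z | K2 z) p z <= \sum_(z | K z) p z.
  rewrite ![\sum_(z | _) p z]big_mkcond -big_split; apply: ler_sum => z _ /=.
  case: (boolP (K1 z)) => [/K12/andP[-> /negbTE->]|_]; first by rewrite addr0.
  by rewrite add0r; case: ifP => [/K2K ->//|_]; case: ifP.
have hK : \sum_(z | K z) p z =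
    \sum_(z | K z && Q z) p z + \sum_(z | K z && ~~ Q z) p z.
  by rewrite (bigID Q).
lra.
Qed.

Let s (z : torus) := signed_rep z.1.
Let t (z : torus) := signed_rep z.2.
Let Q (z : torus) := small z.1 && small z.2.

Lemma power_total :
  power f 0 = 0 ->
  \sum_z power f z <= 4 * (\sum_(z | ~~ Q z) power f z)
    + 6 * (\sum_z dft_gap (@shear1 k) z + \sum_z dft_gap (@shear2 k) z
         + \sum_z dft_gap (@unshear1 k) z + \sum_z dft_gap (@unshear2 k) z).
Proof.
move=> p0.
(* [K] and [K'] are two pairs of opposite half-open quadrants that partition the nonzero
   frequencies. Both shears push [K] into itself, and both inverse shears push [K'] into itself. *)
pose K z := (0 < s z) && (0 <= t z) || (s z < 0) && (t z <= 0).
pose K' z := (0 < t z) && (s z <= 0) || (t z < 0) && (0 <= s z).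
have h1 := @ping_pong (@shear1 k) (@shear2 k) K Q
  (fun z => (0 <= t z) && (t z < s z) || (t z <= 0) && (s z < t z))
  (fun z => (0 < s z) && (s z <= t z) || (s z < 0) && (t z <= s z))
  (can_inj (@shear1K k)) (can_inj (@shear2K k)).
have h2 := @ping_pong (@unshear1 k) (@unshear2 k) K' Q
  (fun z => (0 < t z) && (s z <= - t z) || (t z < 0) && (- t z <= s z))
  (fun z => (s z <= 0) && (- s z < t z) || (0 <= s z) && (t z < - s z))
  (can_inj (@unshear1K k)) (can_inj (@unshear2K k)).
have hT : \sum_z p z <= \sum_(z | K z) p z + \sum_(z | K' z) p z.
  rewrite ![\sum_(z | _) p z]big_mkcond -big_split; apply: ler_sum => z _ /=.
  case: (eqVneq z 0) => [->|z0].
    by rewrite /p p0; case: (K 0); case: (K' 0); rewrite ?addr0.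
  have : K z || K' z.
    have : (s z != 0) || (t z != 0).
      rewrite -negb_and; apply: contra z0 => /andP[/eqP a /eqP b].
      by rewrite -pair_eqE /= (signed_rep_eq0 a) (signed_rep_eq0 b) eqxx.
    by rewrite /K /K'; move: (s z) (t z) => a b; lia.
  by have := power_ge0 z; case: (K z); case: (K' z) => //; lra.
have hQ : \sum_(z | K z && ~~ Q z) p z + \sum_(z | K' z && ~~ Q z) p z <=
    \sum_(z | ~~ Q z) p z.
  rewrite ![\sum_(z | _) p z]big_mkcond -big_split; apply: ler_sum => z _ /=.
  have : ~~ (K z && K' z) by rewrite /K /K'; move: (s z) (t z) => a b; lia.
  by have := power_ge0 z; case: (K z); case: (K' z); case: (Q z) => //= *; lra.
suff : \sum_(z | K z) p z + \sum_(z | K' z) p z <=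
  4 * (\sum_(z | K z && ~~ Q z) p z + \sum_(z | K' z && ~~ Q z) p z) +
  6 * (\sum_z dft_gap (@shear1 k) z + \sum_z dft_gap (@shear2 k) z
         + \sum_z dft_gap (@unshear1 k) z + \sum_z dft_gap (@unshear2 k) z).
  by rewrite /p; lra.
suff [a b] : (\sum_(z | K z) p z <= 4 * (\sum_(z | K z && ~~ Q z) p z)
    + 6 * (\sum_z dft_gap (@shear1 k) z + \sum_z dft_gap (@shear2 k) z)) /\
  (\sum_(z | K' z) p z <= 4 * (\sum_(z | K' z && ~~ Q z) p z)
    + 6 * (\sum_z dft_gap (@unshear1 k) z + \sum_z dft_gap (@unshear2 k) z)).
  by lra.
have B1 z : Q z -> signed_rep (z.1 + z.2) = s z + t z.
  by case/andP => *; exact: signed_repD.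
have B2 z : Q z -> signed_rep (z.2 + z.1) = t z + s z.
  by case/andP => *; exact: signed_repD.
have B3 z : Q z -> signed_rep (z.1 - z.2) = s z - t z.
  by case/andP => a b; rewrite signed_repD ?smallN// signed_repN.
have B4 z : Q z -> signed_rep (z.2 - z.1) = t z - s z.
  by case/andP => a b; rewrite signed_repD ?smallN// signed_repN.
split.
- apply: h1 => z; rewrite ?/K /s /t /=.
  + by move=> Kz Qz; rewrite B1//; move: Kz; rewrite /s /t; lia.
  + by move=> Kz Qz; rewrite B2//; move: Kz; rewrite /s /t; lia.
  + by lia.
  + by lia.
- apply: h2 => z; rewrite ?/K' /s /t /=.
  + by move=> Kz Qz; rewrite B3//; move: Kz; rewrite /s /t; lia.
  + by move=> Kz Qz; rewrite B4//; move: Kz; rewrite /s /t; lia.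
  + by lia.
  + by lia.
Qed.

End PingPong.

(** A mean zero function has no mass at frequency 0. Its mass at frequencies that are not small is
    controlled by the two translations, and [power_total] controls the rest by the shears. Each
    shear gap occurs twice, once for the inverse, whence 12 = 2 * 6. *)
Lemma torus_displacement (R : realType) (k : nat)
    (f : 'I_k.+2 * 'I_k.+2 -> R) : \sum_w f w = 0 ->
  \sum_w f w ^+ 2 <= 12 *
    (\sum_w (f w - f (w + (1, 0))) ^+ 2 + \sum_w (f w - f (w + (0, 1))) ^+ 2 +
     \sum_w (f w - f (shear1 w)) ^+ 2 + \sum_w (f w - f (shear2 w)) ^+ 2).
Proof.
move=> f0; pose n2 : R := k.+2%:R ^+ 2.
have n2_gt0 : 0 < n2 by rewrite exprn_gt0// ltr0n.
have p0 : power f 0 = 0.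
  rewrite /power /dft_cos /dft_sin.
  rewrite (eq_bigr f) => [|w _]; last first.
    by rewrite /dot !mul0r addr0 chi_cos0 mulr1.
  rewrite f0 big1 => [|w _]; first by rewrite expr0n addr0.
  by rewrite /dot !mul0r addr0 chi_sin0 mulr0.
have shiftE w0 : \sum_z power f z * (2 - 2 * chi_cos R (dot z w0)) =
    n2 * \sum_w (f w - f (w + w0)) ^+ 2.
  by rewrite -(parseval (f \- (fun w => f (w + w0)))); apply: eq_bigr => z _;
    rewrite power_shift.
have gap1 : \sum_z dft_gap f (@unshear2 k) z = n2 * \sum_w (f w - f (shear1 w)) ^+ 2.
  rewrite -(parseval (f \- (f \o @shear1 k))); apply: eq_bigr => z _.
  by rewrite /power dft_cosB dft_sinB (dft_shear1 _ _).1 (dft_shear1 _ _).2.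
have gap2 : \sum_z dft_gap f (@unshear1 k) z = n2 * \sum_w (f w - f (shear2 w)) ^+ 2.
  rewrite -(parseval (f \- (f \o @shear2 k))); apply: eq_bigr => z _.
  by rewrite /power dft_cosB dft_sinB (dft_shear2 _ _).1 (dft_shear2 _ _).2.
have gap3 : \sum_z dft_gap f (@shear2 k) z = \sum_z dft_gap f (@unshear2 k) z.
  rewrite (reindex_inj (can_inj (@unshear2K k))); apply: eq_bigr => z _.
  by rewrite /dft_gap unshear2K; ring.
have gap4 : \sum_z dft_gap f (@shear1 k) z = \sum_z dft_gap f (@unshear1 k) z.
  rewrite (reindex_inj (can_inj (@unshear1K k))); apply: eq_bigr => z _.
  by rewrite /dft_gap unshear1K; ring.
(* A coordinate that is not small has a cosine at most 0, so its factor 2 - 2 cos is at least 2. *)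
have far : 2 * (\sum_(z : 'I_k.+2 * 'I_k.+2 | ~~ (small z.1 && small z.2)) power f z) <=
    \sum_z power f z * (2 - 2 * chi_cos R (dot z (1, 0))) +
    \sum_z power f z * (2 - 2 * chi_cos R (dot z (0, 1))).
  rewrite mulr_sumr big_mkcond -big_split; apply: ler_sum => z _ /=.
  have -> : dot z (1, 0) = z.1 by rewrite /dot /= mulr1 mulr0 addr0.
  have -> : dot z (0, 1) = z.2 by rewrite /dot /= mulr1 mulr0 add0r.
  have q0 : 0 <= power f z by rewrite addr_ge0 ?sqr_ge0.
  have c1 : chi_cos R z.1 <= 1 by exact: cos_le1.
  have c2 : chi_cos R z.2 <= 1 by exact: cos_le1.
  case: ifP => [|_]; last by rewrite addr_ge0// mulr_ge0//; lra.
  by rewrite negb_and => /orP[] /(@chi_cos_not_small R) h; nra.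
have := power_total p0; rewrite gap3 gap4 gap1 gap2 parseval -/n2.
move: far; rewrite !shiftE.
set e1 := \sum_w (f w - f (w + (1, 0))) ^+ 2.
set e2 := \sum_w (f w - f (w + (0, 1))) ^+ 2.
set e3 := \sum_w _ ^+ 2; set e4 := \sum_w _ ^+ 2; set e5 := \sum_w _ ^+ 2.
move=> far tot; rewrite -(ler_pM2l n2_gt0).
have e1_ge0 : 0 <= n2 * e1 by apply: mulr_ge0; [exact: ltW|exact/sumr_ge0/(fun _ _ => sqr_ge0 _)].
have e2_ge0 : 0 <= n2 * e2 by apply: mulr_ge0; [exact: ltW|exact/sumr_ge0/(fun _ _ => sqr_ge0 _)].
lra.
Qed.

(** [c] bounds the square of the norm, on mean zero functions, of the unnormalised sum of the maps.
    For bijections the trivial value is the square of the size of [I]. *)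
Definition contracting (R : realType) (X I : finType) (phi : I -> X -> X) (c : R) :=
  forall f : X -> R, \sum_w f w = 0 ->
    \sum_w (\sum_i f (phi i w)) ^+ 2 <= c * \sum_w f w ^+ 2.

(** * Words in the translations and shears *)

Section Torus.
Variables (R : realType) (k : nat).
Notation torus := ('I_k.+2 * 'I_k.+2)%type.

Definition torus_map (i : 'I_5) : torus -> torus :=
  nth id [:: id; fun w => w + (1, 0); fun w => w + (0, 1); @shear1 k; @shear2 k] i.

Lemma torus_map_inj i : injective (torus_map i).
Proof.
case: i => -[|[|[|[|[|//]]]]] i5; rewrite /torus_map /=; first by [].
- exact: addIr.
- exact: addIr.
- exact: can_inj (@shear1K k).
- exact: can_inj (@shear2K k).
Qed.

(** The square of a sum of five terms is five times the sum of squares minus all squared pairwise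
    differences. Since the identity is one of the maps, four of these differences are displacements
    of [f], which [torus_displacement] bounds below. *)
Lemma torus_contracting : contracting torus_map (25 - 12^-1 : R).
Proof.
move=> f f0; have := torus_displacement f0.
pose g1 w : torus := w + (1, 0); pose g2 w : torus := w + (0, 1).
have inv (g : torus -> torus) : injective g -> \sum_w f (g w) ^+ 2 = \sum_w f w ^+ 2.
  by move=> ig; rewrite [RHS](reindex_inj ig).
have j1 := inv g1 (@addIr _ _); have j2 := inv g2 (@addIr _ _).
have j3 := inv _ (can_inj (@shear1K k)); have j4 := inv _ (can_inj (@shear2K k)).
have H : \sum_w (\sum_i f (torus_map i w)) ^+ 2 <=
  \sum_w (5 * (f w ^+ 2 + f (g1 w) ^+ 2 + f (g2 w) ^+ 2 + f (shear1 w) ^+ 2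
               + f (shear2 w) ^+ 2)
    - ((f w - f (g1 w)) ^+ 2 + (f w - f (g2 w)) ^+ 2 +
       (f w - f (shear1 w)) ^+ 2 + (f w - f (shear2 w)) ^+ 2)).
  apply: ler_sum => w _; rewrite !big_ord_recl big_ord0 /torus_map /= addr0.
  rewrite -/(g1 w) -/(g2 w).
  move: (f w) (f (g1 w)) (f (g2 w)) (f (shear1 w)) (f (shear2 w)) => a b c d e.
  have := sqr_ge0 (b - c); have := sqr_ge0 (b - d); have := sqr_ge0 (b - e).
  have := sqr_ge0 (c - d); have := sqr_ge0 (c - e); have := sqr_ge0 (d - e).
  lra.
move: H; rewrite sumrB -mulr_sumr !big_split /= j1 j2 j3 j4.
lra.
Qed.

(** The sum over the maps preserves mean zero, so the bound is multiplicative along words. Different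
    words may give the same map, hence an indexed family. *)
Lemma contracting_words j : exists (I : finType) (phi : I -> torus -> torus),
  [/\ #|I| = (5 ^ j)%N, forall i, injective (phi i)
    & contracting phi ((25 - 12^-1) ^+ j : R)].
Proof.
elim: j => [|j [I [phi [cI injI IH]]]].
  exists unit, (fun=> id); split => [|_|f _]; [by rewrite card_unit|by []|].
  rewrite expr0 mul1r; apply: ler_sum => w _.
  by rewrite (eq_bigr (fun=> f w))// sumr_const card_unit.
exists ('I_5 * I)%type, (fun i w => phi i.2 (torus_map i.1 w)).
split => [|i|f f0]; first by rewrite card_prod card_ord cI expnS.
  by apply: inj_comp; [exact: injI|exact: torus_map_inj].
pose g w := \sum_i f (phi i w).
have g0 : \sum_w g w = 0.
  rewrite exchange_big /= big1 // => i _.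
  by rewrite -[RHS]f0 [RHS](reindex_inj (@injI i)).
rewrite exprS -mulrA (le_trans _ (ler_wpM2l _ (IH f f0)))//; last by lra.
apply: le_trans (torus_contracting g0); apply: ler_sum => w _.
rewrite le_eqVlt; apply/orP; left; apply/eqP; congr (_ ^+ 2).
by rewrite pair_bigA.
Qed.

End Torus.

(** * Simple expanders *)

Lemma sum_pairR (R : realType) (A B : finType) (F : A * B -> R) :
  \sum_p F p = \sum_a \sum_b F (a, b).
Proof. by rewrite pair_bigA; apply: eq_bigr => -[]. Qed.

Lemma sqr_sum_le (R : realType) (I : finType) (F : I -> R) :
  (\sum_i F i) ^+ 2 <= #|I|%:R * \sum_i F i ^+ 2.
Proof.
have : 0 <= \sum_i \sum_j (F i - F j) ^+ 2.
  by apply: sumr_ge0 => i _; apply: sumr_ge0 => j _; exact: sqr_ge0.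
have -> : \sum_i \sum_j (F i - F j) ^+ 2 =
    2 * (#|I|%:R * \sum_i F i ^+ 2) - 2 * (\sum_i F i) ^+ 2.
  have rowE i : \sum_j (F i - F j) ^+ 2 =
      #|I|%:R * F i ^+ 2 + \sum_j F j ^+ 2 - 2 * (F i * \sum_j F j).
    rewrite mulr_natl -sumr_const 2!mulr_sumr -big_split -sumrB.
    by apply: eq_bigr => j _ /=; ring.
  rewrite (eq_bigr _ (fun i _ => rowE i)) sumrB big_split /= -!mulr_sumr -mulr_suml.
  rewrite sumr_const -[X in _ + X - _]mulr_natl.
  by rewrite expr2; ring.
lra.
Qed.

(** * Point-line incidences of a finite affine plane *)

Section Lines.
Variables (R : realType) (F : finFieldType).
Notation q := (#|F|%:R : R).
Implicit Types (h : F * F -> R) (lambda : F).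

(** A pair (s, e) stands for the line Y = s X + e. The sum runs over the non-vertical lines through
    [p] moved down by [lambda]. *)
Definition line_sum h lambda (p : F * F) : R :=
  \sum_s h (s, p.2 - s * p.1 - lambda).

Lemma sum_line_sum h lambda : \sum_p line_sum h lambda p = q * \sum_p h p.
Proof.
rewrite exchange_big /= [in RHS]sum_pairR mulr_sumr; apply: eq_bigr => s _.
rewrite (sum_pairR (fun p => h (s, p.2 - s * p.1 - lambda))) /=.
rewrite (eq_bigr (fun=> \sum_e h (s, e))) => [|x _].
  by rewrite sumr_const mulr_natl.
rewrite [RHS](reindex_inj (addIr (- (s * x) - lambda))).
by apply: eq_bigr => y _; rewrite addrA.
Qed.

(* Lines of different slopes meet in exactly one point. *)
Lemma line_sum_sqr h lambda : \sum_p h p = 0 ->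
  \sum_p line_sum h lambda p ^+ 2 <= q * \sum_p h p ^+ 2.
Proof.
move=> h0; pose hb s := \sum_e h (s, e).
(* For two different slopes, the pair of intercepts is a bijective coordinate system on the plane,
   so the sum over points factors. *)
have cross s s' : s != s' ->
    \sum_p h (s, p.2 - s * p.1 - lambda) * h (s', p.2 - s' * p.1 - lambda) =
    hb s * hb s'.
  move=> ss'; rewrite /hb mulr_suml.
  under [RHS]eq_bigr => e _ do rewrite mulr_sumr.
  rewrite pair_bigA /=.
  have inj : injective
      (fun p : F * F => (p.2 - s * p.1 - lambda, p.2 - s' * p.1 - lambda)).
    move=> [x y] [x' y'] /= [/addIr e1 /addIr e2].
    have : (s' - s) * (x - x') = 0.
      transitivity ((y - s * x) - (y - s' * x) - ((y' - s * x') - (y' - s' * x'))).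
        by ring.
      by rewrite e1 e2; ring.
    move/eqP; rewrite mulf_eq0 subr_eq0 eq_sym (negbTE ss') /= subr_eq0 => /eqP xx.
    by move: e1; rewrite xx => /addIr ->.
  by rewrite [RHS](reindex_inj inj).
have diag s : \sum_p h (s, p.2 - s * p.1 - lambda) * h (s, p.2 - s * p.1 - lambda) =
    q * \sum_e h (s, e) ^+ 2.
  rewrite (sum_pairR (fun p => _)) /= (eq_bigr (fun=> \sum_e h (s, e) ^+ 2)).
    by rewrite sumr_const mulr_natl.
  move=> x _; rewrite [RHS](reindex_inj (addIr (- (s * x) - lambda))).
  by apply: eq_bigr => y _; rewrite addrA expr2.
have -> : \sum_p line_sum h lambda p ^+ 2 =
    \sum_s \sum_s' (hb s * hb s' +
      (if s == s' then q * (\sum_e h (s, e) ^+ 2) - hb s ^+ 2 else 0)).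
  under eq_bigr => p _.
    rewrite expr2 /line_sum mulr_suml.
    under eq_bigr => s _ do rewrite mulr_sumr.
    over.
  rewrite exchange_big; apply: eq_bigr => s _.
  rewrite exchange_big; apply: eq_bigr => s' _.
  case: eqP => [<-|/eqP ss']; first by rewrite diag expr2; ring.
  by rewrite cross// addr0.
have rowE s : \sum_s' (hb s * hb s' +
      (if s == s' then q * (\sum_e h (s, e) ^+ 2) - hb s ^+ 2 else 0)) =
    hb s * (\sum_s' hb s') + (q * (\sum_e h (s, e) ^+ 2) - hb s ^+ 2).
  rewrite big_split /= -mulr_sumr; congr (_ + _).
  by rewrite (bigD1 s)//= eqxx [X in _ + X]big1 ?addr0// => s' /negbTE; rewrite eq_sym => ->.
rewrite (eq_bigr _ (fun s _ => rowE s)) big_split /= -mulr_suml.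
(* The off-diagonal contributions were completed to the square of the total of [h], which is
   zero. *)
have -> : \sum_s hb s = 0 by rewrite -[RHS]h0 sum_pairR.
rewrite mul0r add0r sumrB -mulr_sumr [in leRHS]sum_pairR gerBl.
by apply: sumr_ge0 => s _; exact: sqr_ge0.
Qed.

End Lines.

Definition adj_form (R : realType) (T : finType) (E : rel T) (b : T -> R) : R :=
  \sum_x \sum_y (E x y)%:R * (b x * b y).

(** The fourth clause bounds the adjacency form from above only, since a bipartite regular graph
    also has the eigenvalue -d. The last clause is the Motzkin-Straus bound for bipartite graphs. *)
Definition expander (R : realType) (T : finType) (E : rel T) (d : nat) (sigma : R) :=
  [/\ symmetric E, irreflexive E,
      adj_form E (fun=> 1 : R) = d%:R * #|T|%:R,
      forall b : T -> R, adj_form E b <= d%:R * (\sum_x b x) ^+ 2 / #|T|%:R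
        + sigma * (\sum_x b x ^+ 2 - (\sum_x b x) ^+ 2 / #|T|%:R)
    & forall b : T -> R, (forall x, 0 <= b x) ->
        adj_form E b <= (\sum_x b x) ^+ 2 / 2].

(** * Lifting a contracting family to a simple bipartite graph *)

Section Lift.
Variables (R : realType) (X I : finType) (F : finFieldType).
Variables (phi : I -> X -> X) (lab : I -> F) (c : R).
Hypothesis phi_inj : forall i, injective (phi i).
Hypothesis lab_inj : injective lab.
Hypothesis phi_contr : contracting phi c.
Notation q := (#|F|%:R : R).
Hypothesis F_large : #|I|%:R ^+ 2 <= c * q.

Notation side := (X * (F * F))%type.

(* Each map gets its own parallel class of translates, so that the lifted graph has no
   multiple edges even if the maps phi i coincide at some points. *)
Definition lift_op (g : side -> R) (u : side) : R :=
  \sum_i line_sum (fun p => g (phi i u.1, p)) (lab i) u.2.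

Let q_gt0 : 0 < q.
Proof. by rewrite ltr0n; apply/card_gt0P; exists 0. Qed.

Lemma sum_lift_op g : \sum_u lift_op g u = #|I|%:R * q * \sum_u g u.
Proof.
rewrite exchange_big /= -mulrA mulr_natl -sumr_const; apply: eq_bigr => i _.
rewrite (sum_pairR (fun u => _)) [in RHS]sum_pairR mulr_sumr.
rewrite [RHS](reindex_inj (@phi_inj i)); apply: eq_bigr => z _ /=.
exact: sum_line_sum.
Qed.

(** Split [g] into its fibre averages and a part [gt] with zero sum on each fibre. The averages only
    see the maps [phi i], which gives the factor [c * q ^+ 2]. On [gt] each incidence operator has
    squared norm at most q, so the sum of them has at most [#|I|%:R ^+ 2 * q], and [F_large] absorbs
    this. The two images are orthogonal because [V] has zero fibre sums. *)
Lemma lift_op_sqr g : \sum_u g u = 0 ->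
  \sum_u lift_op g u ^+ 2 <= c * q ^+ 2 * \sum_u g u ^+ 2.
Proof.
move=> g0; have q0 : q != 0 by rewrite gt_eqF.
pose gb z := \sum_p g (z, p).
pose gt (u : side) := g u - gb u.1 / q ^+ 2.
have sum_cst (a : R) : \sum_(p : F * F) a = q ^+ 2 * a.
  by rewrite sumr_const card_prod -[LHS]mulr_natl natrM expr2.
have gt0 z : \sum_p gt (z, p) = 0.
  rewrite sumrB /= sum_cst -/(gb z).
  by move: (gb z) q0; move: q => y b y0; field.
pose U z := \sum_i gb (phi i z).
pose V u := lift_op gt u.
have V0 z : \sum_p V (z, p) = 0.
  rewrite exchange_big big1 // => i _ /=; rewrite sum_line_sum.
  by rewrite (gt0 (phi i z)) mulr0.
have liftE u : lift_op g u = U u.1 / q + V u.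
  rewrite /U mulr_suml -big_split; apply: eq_bigr => i _ /=.
  rewrite /line_sum /gt sumrB /= sumr_const -[X in _ - X]mulr_natl.
  by move: (\sum_s _) (gb _) q0; move: q => y a b y0; field.
have sumU : \sum_z U z ^+ 2 <= c * \sum_z gb z ^+ 2.
  by apply: phi_contr; rewrite -[RHS]g0 [RHS]sum_pairR.
have sumV : \sum_u V u ^+ 2 <= c * q ^+ 2 * \sum_u gt u ^+ 2.
  apply: (@le_trans _ _ (#|I|%:R * (#|I|%:R * (q * \sum_u gt u ^+ 2)))); last first.
    have : 0 <= \sum_u gt u ^+ 2 by apply: sumr_ge0 => u _; exact: sqr_ge0.
    move: (\sum_u _) F_large; move: (#|I|%:R : R) q q_gt0 => y z z0 w yz w0.
    have -> : y * (y * (z * w)) = y ^+ 2 * (z * w) by ring.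
    have -> : c * z ^+ 2 * w = c * z * (z * w) by ring.
    by apply: ler_wpM2r => //; rewrite mulr_ge0// ltW.
  apply: (@le_trans _ _ (\sum_u #|I|%:R *
      \sum_i line_sum (fun p => gt (phi i u.1, p)) (lab i) u.2 ^+ 2)).
    by apply: ler_sum => u _; exact: sqr_sum_le.
  rewrite -mulr_sumr; apply: ler_wpM2l; first exact: ler0n.
  rewrite exchange_big /= [leRHS]mulr_natl -sumr_const; apply: ler_sum => i _.
  rewrite (sum_pairR (fun u => _)) [in leRHS]sum_pairR mulr_sumr.
  rewrite [leRHS](reindex_inj (@phi_inj i)); apply: ler_sum => z _ /=.
  exact: line_sum_sqr.
have -> : \sum_u lift_op g u ^+ 2 = \sum_z U z ^+ 2 + \sum_u V u ^+ 2.
  rewrite !(sum_pairR (fun u => _ ^+ 2)) -big_split; apply: eq_bigr => z _ /=.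
  have lE p : lift_op g (z, p) ^+ 2 =
      (U z / q) ^+ 2 + 2 * (U z / q) * V (z, p) + V (z, p) ^+ 2.
    by rewrite liftE /=; ring.
  rewrite (eq_bigr _ (fun p _ => lE p)) !big_split /= sum_cst -mulr_sumr V0.
  by move: (\sum_i _) (U z) q0; move: q => y a b y0; field.
have -> : \sum_u g u ^+ 2 = (\sum_z gb z ^+ 2) / q ^+ 2 + \sum_u gt u ^+ 2.
  rewrite !(sum_pairR (fun u => _ ^+ 2)) mulr_suml -big_split.
  apply: eq_bigr => z _ /=.
  have gE p : g (z, p) ^+ 2 = (gb z / q ^+ 2) ^+ 2
      + 2 * (gb z / q ^+ 2) * gt (z, p) + gt (z, p) ^+ 2.
    by rewrite /gt /=; ring.
  rewrite (eq_bigr _ (fun p _ => gE p)) !big_split /= sum_cst -mulr_sumr gt0.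
  by move: (\sum_i _) (gb z) q0; move: q => y a b y0; field.
have -> : c * q ^+ 2 * ((\sum_z gb z ^+ 2) / q ^+ 2 + \sum_u gt u ^+ 2) =
    c * (\sum_z gb z ^+ 2) + c * q ^+ 2 * \sum_u gt u ^+ 2.
  by move: (\sum_z _) (\sum_u _) q0; move: q => y a b y0; field.
exact: lerD.
Qed.

Definition lift_adj (u r : side) : bool :=
  [exists i, (r.1 == phi i u.1) && (r.2.2 == u.2.2 - r.2.1 * u.2.1 - lab i)].

Lemma sum_lift_adj g u : \sum_r (lift_adj u r)%:R * g r = lift_op g u.
Proof.
have adjE r : (lift_adj u r)%:R =
    \sum_i ((r.1 == phi i u.1) && (r.2.2 == u.2.2 - r.2.1 * u.2.1 - lab i))%:R :> R.
  rewrite /lift_adj; case: existsP => [[i hi]|h]; last first.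
    rewrite big1// => i _; case: (boolP (_ && _)) => // hi.
    by case: h; exists i.
  rewrite (bigD1 i)//= hi big1 ?addr0// => j ji.
  (* The intercept equation determines [lab i], so an adjacent pair has exactly one witness. *)
  case: (boolP (_ && _)) => // /andP[_ /eqP hj].
  case/andP: hi => _ /eqP; rewrite hj => /addrI/oppr_inj/lab_inj e.
  by rewrite e eqxx in ji.
under eq_bigr => r _ do rewrite adjE mulr_suml.
rewrite exchange_big; apply: eq_bigr => i _ /=.
rewrite (sum_pairR (fun r => _)) /= (bigD1 (phi i u.1))//= [X in _ + X]big1 => [|z zi].
  rewrite addr0 (sum_pairR (fun r => _)) /=; apply: eq_bigr => s _.
  rewrite (bigD1 (u.2.2 - s * u.2.1 - lab i))//= !eqxx mul1r big1 ?addr0// => e.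
  by move/negbTE => ->; rewrite mul0r.
by apply: big1 => p _; rewrite (negbTE zi) mul0r.
Qed.

Lemma lift_opB g a u :
  lift_op (fun r => g r - a) u = lift_op g u - #|I|%:R * q * a.
Proof.
have -> : #|I|%:R * q * a = \sum_(i : I) \sum_(s : F) a.
  by rewrite !sumr_const -mulrnA mulnC -[RHS]mulr_natl natrM.
rewrite -sumrB; apply: eq_bigr => i _.
by rewrite /line_sum sumrB.
Qed.

Definition lift_graph (x y : side + side) : bool :=
  match x, y with
  | inl u, inr r | inr r, inl u => lift_adj u r
  | _, _ => false
  end.

Lemma adj_form_lift (b : side + side -> R) :
  adj_form lift_graph b = 2 * \sum_u b (inl u) * lift_op (b \o inr) u.
Proof.
have sumE (G : side + side -> R) : \sum_x G x = \sum_u G (inl u) + \sum_u G (inr u).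
  by rewrite big_sumType.
have e1 : \sum_u \sum_y (lift_graph (inl u) y)%:R * (b (inl u) * b y) =
    \sum_u b (inl u) * lift_op (b \o inr) u.
  apply: eq_bigr => u _; rewrite sumE /= big1 ?add0r => [|r _]; last by rewrite mul0r.
  rewrite -sum_lift_adj mulr_sumr; apply: eq_bigr => r _ /=; ring.
have e2 : \sum_r \sum_y (lift_graph (inr r) y)%:R * (b (inr r) * b y) =
    \sum_u b (inl u) * lift_op (b \o inr) u.
  rewrite -e1.
  under eq_bigr => r _ do rewrite sumE /=.
  under [in RHS]eq_bigr => r _ do rewrite sumE /=.
  rewrite !big_split /= [X in _ + X]big1 => [|r _]; last first.
    by rewrite big1// => u _; rewrite mul0r.
  rewrite [X in _ = X + _]big1 => [|r _]; last first.
    by rewrite big1// => u _; rewrite mul0r.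
  rewrite addr0 add0r exchange_big; apply: eq_bigr => u _; apply: eq_bigr => r _ /=.
  by ring.
by rewrite /adj_form sumE e1 e2; ring.
Qed.

Lemma lift_expander (x0 : X) (sigma : R) : 0 < sigma -> sigma ^+ 2 = c * q ^+ 2 ->
  expander lift_graph (#|I| * #|F|)%N sigma.
Proof.
move=> sigma_gt0 sigmaE.
pose S : R := #|{: side}|%:R.
have S_gt0 : 0 < S by rewrite ltr0n; apply/card_gt0P; exists (x0, (0, 0)).
have S0 : S != 0 by rewrite gt_eqF.
have cardT : #|{: side + side}|%:R = 2 * S :> R.
  by rewrite card_sum natrD /S; ring.
have sum_cst (a : R) : \sum_(u : side) a = S * a by rewrite sumr_const -[LHS]mulr_natl.
pose d : R := #|I|%:R * q.
have dE : (#|I| * #|F|)%N%:R = d by rewrite natrM.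
split.
- by case=> u [] r.
- by case.
- rewrite adj_form_lift cardT dE.
  have -> : \sum_(u : side) 1 * lift_op ((fun=> 1 : R) \o @inr side side) u = d * S.
    under eq_bigr => u _ do rewrite mul1r.
    by rewrite sum_lift_op /= sum_cst mulr1.
  by ring.
- move=> b; rewrite adj_form_lift cardT dE !big_sumType /=.
  set X1 := \sum_u b (inl u); set X2 := \sum_u b (inr u).
  pose b' u := b (inl u) - X1 / S; pose c' u := b (inr u) - X2 / S.
  have b'0 : \sum_u b' u = 0 by rewrite sumrB sum_cst -/X1; field.
  have c'0 : \sum_u c' u = 0 by rewrite sumrB sum_cst -/X2; field.
  have b'sqr : \sum_u b (inl u) ^+ 2 = \sum_u b' u ^+ 2 + X1 ^+ 2 / S.
    have E u : b (inl u) ^+ 2 = b' u ^+ 2 + 2 * (X1 / S) * b' u + (X1 / S) ^+ 2.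
      by rewrite /b'; ring.
    rewrite (eq_bigr _ (fun u _ => E u)) !big_split /= -mulr_sumr b'0 sum_cst.
    by field.
  have c'sqr : \sum_u b (inr u) ^+ 2 = \sum_u c' u ^+ 2 + X2 ^+ 2 / S.
    have E u : b (inr u) ^+ 2 = c' u ^+ 2 + 2 * (X2 / S) * c' u + (X2 / S) ^+ 2.
      by rewrite /c'; ring.
    rewrite (eq_bigr _ (fun u _ => E u)) !big_split /= -mulr_sumr c'0 sum_cst.
    by field.
  have formE : \sum_u b (inl u) * lift_op (b \o inr) u =
      \sum_u b' u * lift_op c' u + d * X1 * X2 / S.
    have E u : b (inl u) * lift_op (b \o inr) u =
        b' u * lift_op c' u + X1 / S * lift_op c' u + d * X2 / S * b (inl u).
      by rewrite /b' /c' lift_opB -/d /=; ring.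
    rewrite (eq_bigr _ (fun u _ => E u)) !big_split /= -!mulr_sumr sum_lift_op c'0 -/X1.
    by field.
  (* The weight [sigma] in the inequality between the means balances the two squares, since
     [sigma ^+ 2] is the bound of [lift_op_sqr]. *)
  have bilin : 2 * (\sum_u b' u * lift_op c' u) <=
      sigma * (\sum_u b' u ^+ 2 + \sum_u c' u ^+ 2).
    have : \sum_u 2 * (b' u * lift_op c' u) <=
        \sum_u (sigma * b' u ^+ 2 + sigma^-1 * lift_op c' u ^+ 2).
      apply: ler_sum => u _; move: (b' u) (lift_op _ _) => y z.
      have : 0 <= sigma^-1 * (sigma * y - z) ^+ 2.
        by rewrite mulr_ge0 ?sqr_ge0// invr_ge0 ltW.
      have -> : sigma^-1 * (sigma * y - z) ^+ 2 =
          sigma * y ^+ 2 + sigma^-1 * z ^+ 2 - 2 * (y * z).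
        by field; rewrite gt_eqF.
      by rewrite subr_ge0.
    rewrite big_split /= -!mulr_sumr => h; apply: le_trans h _.
    rewrite mulrDr lerD2l mulrC ler_pdivrMr// -mulrA mulrC -mulrA -expr2 sigmaE mulrC.
    exact: lift_op_sqr.
  have sq := sqr_ge0 (X1 - X2).
  have S2_ge0 : 0 <= 2 * S by rewrite mulr_ge0// ltW.
  have d_ge0 : 0 <= d by rewrite mulr_ge0 ?ler0n.
  have h1 : 2 * (d * X1 * X2 / S) <= d * (X1 + X2) ^+ 2 / (2 * S).
    rewrite -subr_ge0.
    have -> : d * (X1 + X2) ^+ 2 / (2 * S) - 2 * (d * X1 * X2 / S) =
        d * (X1 - X2) ^+ 2 / (2 * S) by field.
    by apply: divr_ge0 => //; exact: mulr_ge0.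
  (* Centring each side separately leaves at most the variance about the common mean. *)
  have h2 : (X1 + X2) ^+ 2 / (2 * S) <= X1 ^+ 2 / S + X2 ^+ 2 / S.
    rewrite -subr_ge0.
    have -> : X1 ^+ 2 / S + X2 ^+ 2 / S - (X1 + X2) ^+ 2 / (2 * S) =
        (X1 - X2) ^+ 2 / (2 * S) by field.
    exact: divr_ge0.
  rewrite formE b'sqr c'sqr mulrDr.
  have h3 : sigma * (\sum_u b' u ^+ 2 + \sum_u c' u ^+ 2) <= sigma *
      (\sum_i b' i ^+ 2 + X1 ^+ 2 / S + (\sum_i c' i ^+ 2 + X2 ^+ 2 / S) -
       (X1 + X2) ^+ 2 / (2 * S)).
    by apply: ler_wpM2l; [exact: ltW|lra].
  lra.
- move=> b b0; rewrite adj_form_lift !big_sumType /=.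
  set X1 := \sum_u b (inl u); set X2 := \sum_u b (inr u).
  suff : \sum_u b (inl u) * lift_op (b \o inr) u <= X1 * X2.
    by have := sqr_ge0 (X1 - X2); lra.
  rewrite mulr_suml; apply: ler_sum => u _; apply: ler_wpM2l => //.
  rewrite -sum_lift_adj; apply: ler_sum => r _ /=.
  by case: (lift_adj _ _); rewrite ?mul1r ?mul0r.
Qed.

End Lift.

Lemma expander_family (R : realType) (C : R) : 0 <= C ->
  exists (d : nat) (sigma : R) (a : nat) (T : nat -> finType) (E : forall n, rel (T n)),
    [/\ 1 <= sigma, C * sigma < d%:R, (0 < a)%N,
        forall n, #|T n| = (a * n.+2 ^ 2)%N & forall n, expander (E n) d sigma].
Proof.
move=> C_ge0; pose base : R := 25 - 12^-1.
have [j Cj] : exists j : nat, 299 * C ^+ 2 < j%:R.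
  by exists (Num.bound (299 * C ^+ 2)); rewrite archi_boundP// mulr_ge0// sqr_ge0.
pose c : R := base ^+ j.
have c_ge1 : 1 <= c by rewrite exprn_ege1// /base; lra.
have Cc : C ^+ 2 * c < (5 ^ j)%N%:R ^+ 2.
  (* As 25 / [base] = 300 / 299, this is Bernoulli's inequality. The ratio d / [sigma] will be the
     square root of (25 / [base])^j, so it exceeds [C]. *)
  have bern : c * (1 + j%:R / 299) <= 25 ^+ j.
    rewrite /c; elim: (j) => [|i IH]; first by rewrite !expr0 mul0r addr0 mul1r.
    have bi : 0 <= base ^+ i by rewrite exprn_ge0// /base; lra.
    have i0 : 0 <= (i%:R : R) by rewrite ler0n.
    have := mulr_ge0 bi i0; rewrite !exprS -[i.+1%:R]natr1.
    by move: IH; move: (base ^+ i) (25 ^+ i) => x y; rewrite /base; lra.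
  rewrite natrX -exprM mulnC exprM (_ : 5%:R ^+ 2 = 25); last by ring.
  apply: lt_le_trans bern; rewrite mulrC ltr_pM2l ?(lt_le_trans ltr01 c_ge1)//.
  by lra.
(* A prime of this size provides both distinct labels for all words and [F_large]; it does not
   depend on n, hence neither do the degree and [sigma]. *)
have [q q_gt q_pr] := prime_above ((5 ^ j) ^ 2).
have cardF : #|'F_q| = q by rewrite card_Fp.
pose sigma := Num.sqrt c * q%:R.
have q_ge1 : 1 <= (q%:R : R) by rewrite ler1n prime_gt0.
have sigma_ge1 : 1 <= sigma.
  by rewrite -[leLHS]mulr1 ler_pM// -[leLHS]sqrtr1 ler_wsqrtr.
pose T n : finType :=
  ((('I_n.+2 * 'I_n.+2) * ('F_q * 'F_q)) + (('I_n.+2 * 'I_n.+2) * ('F_q * 'F_q)))%type.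
have exE n : exists E : rel (T n), expander E (5 ^ j * q) sigma.
  have [I [phi [cI phi_inj phi_contr]]] := contracting_words R n j.
  have IF : (#|I| <= #|'F_q|)%N.
    rewrite cI cardF (leq_trans _ (ltnW q_gt))// -[leqLHS]expn1 leq_pexp2l//.
    by rewrite expn_gt0.
  pose lab i : 'F_q := enum_val (widen_ord IF (enum_rank i)).
  have lab_inj : injective lab.
    by move=> x y /enum_val_inj /(congr1 val) /= /val_inj /enum_rank_inj.
  have cq : #|I|%:R ^+ 2 <= c * #|'F_q|%:R.
    rewrite cI cardF (@le_trans _ _ q%:R) ?ler_peMl ?ler0n//.
    by rewrite -natrX ler_nat ltnW.
  exists (lift_graph phi lab).
  have := @lift_expander R _ I 'F_q phi lab c phi_inj lab_inj phi_contr cq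
    (0, 0) sigma.
  rewrite cI cardF; apply; first exact: lt_le_trans ltr01 sigma_ge1.
  by rewrite exprMn sqr_sqrtr// (le_trans ler01 c_ge1).
exists (5 ^ j * q)%N, sigma, (2 * q ^ 2)%N, T, (fun n => projT1 (cid (exE n))).
split => // [||n|n].
- rewrite /sigma natrM mulrA ltr_pM2r ?(lt_le_trans ltr01 q_ge1)//.
  rewrite -(@ltr_pXn2r _ 2)// ?nnegrE ?mulr_ge0 ?sqrtr_ge0 ?ler0n//.
  by rewrite exprMn sqr_sqrtr// (le_trans ler01 c_ge1).
- by rewrite muln_gt0 expn_gt0 (prime_gt0 q_pr).
- by rewrite card_sum !card_prod card_ord cardF !expnS; lia.
- exact: (projT2 (cid (exE n))).
Qed.

(** * The limit polynomial *)

Section LimitPolynomial.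
Variables (R : realType) (u : R).

(* The polynomial H of the header for 2m = u^-2, W = 1 - x - v. *)
Definition limit_poly (x v : R) : R :=
  let W := 1 - x - v in
  1 - (x + v) ^+ 3 - 3 * W ^+ 2 * u ^+ 2 + 2 * W ^+ 3 * u ^+ 4
  - 3 * W ^+ 2 * u ^+ 2 * x - 3 * W * v ^+ 2.

Definition triangle (x v : R) := [/\ 0 <= x, 0 <= v & x + v <= 1].

Lemma limit_poly_max : exists x v, triangle x v /\
  forall x' v', triangle x' v' -> limit_poly x' v' <= limit_poly x v.
Proof.
pose A := `[0, 1]%classic `*` `[0, 1]%classic : set (R * R).
(* The triangle is parametrised by the unit square through the total x + v and the share of x in it,
   so that compactness comes from a product of segments. *)
pose F (z : R * R) := limit_poly (z.1 * z.2) (z.1 * (1 - z.2)).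
have A0 : A !=set0 by exists (0, 0); split; rewrite /= in_itv /= lexx ler01.
have cA : compact A by apply: compact_setX; exact: segment_compact.
have cF : continuous F.
  have c1 : continuous (fun z : R * R => z.1) by move=> z; exact: cvg_fst.
  have c2 : continuous (fun z : R * R => z.2) by move=> z; exact: cvg_snd.
  have cst (a : R) : continuous (fun _ : R * R => a) by move=> z; exact: cvg_cst.
  have cD (f g : R * R -> R) : continuous f -> continuous g ->
      continuous (fun z => f z + g z) by move=> cf cg z; exact: cvgD (cf z) (cg z).
  have cN (f : R * R -> R) : continuous f -> continuous (fun z => - f z).
    by move=> cf z; exact: cvgN (cf z).
  have cM (f g : R * R -> R) : continuous f -> continuous g ->
      continuous (fun z => f z * g z) by move=> cf cg z; exact: cvgM (cf z) (cg z).
  have cX (f : R * R -> R) n : continuous f -> continuous (fun z => f z ^+ n).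
    move=> cf; elim: n => [|n IH]; first exact: cst.
    by under eq_fun do rewrite exprS; exact: cM.
  have cx : continuous (fun z : R * R => z.1 * z.2) := cM _ _ c1 c2.
  have cv : continuous (fun z : R * R => z.1 * (1 - z.2)) :=
    cM _ _ c1 (cD _ _ (cst 1) (cN _ c2)).
  have cW : continuous (fun z : R * R => 1 - z.1 * z.2 - z.1 * (1 - z.2)) :=
    cD _ _ (cD _ _ (cst 1) (cN _ cx)) (cN _ cv).
  pose c3W2 := cM _ _ (cM _ _ (cst 3) (cX _ 2 cW)) (cst (u ^+ 2)).
  have cY3 := cD _ _ (cst 1) (cN _ (cX _ 3 (cD _ _ cx cv))).
  have c2W3 := cM _ _ (cM _ _ (cst 2) (cX _ 3 cW)) (cst (u ^+ 4)).
  have c3Wv := cM _ _ (cM _ _ (cst 3) cW) (cX _ 2 cv).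
  exact: (cD _ _ (cD _ _ (cD _ _ (cD _ _ cY3 (cN _ c3W2)) c2W3)
    (cN _ (cM _ _ c3W2 cx))) (cN _ c3Wv)).
have [|[a b] /set_mem [/=]] := @compact_EVT_max _ R F A A0 cA.
  exact: continuous_subspaceT.
rewrite !in_itv /= => /andP[a0 a1] /andP[b0 b1] Fmax.
exists (a * b), (a * (1 - b)); split; first by split; nra.
move=> x v [x0 v0 xv1].
have [xv0|xv0] := eqVneq (x + v) 0.
  have -> : x = 0 * 0 by lra.
  have -> : v = 0 * (1 - 0) by lra.
  apply: (Fmax (0, 0)); apply: mem_set.
  by split; rewrite /= in_itv /= lexx ler01.
have xv_gt0 : 0 < x + v by rewrite lt_neqAle eq_sym xv0 addr_ge0.
have xE : x = (x + v) * (x / (x + v)) by field.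
have vE : v = (x + v) * (1 - x / (x + v)) by field.
rewrite [in leLHS]vE {1}xE; apply: (Fmax (x + v, x / (x + v))); apply: mem_set.
split; rewrite /= in_itv /=; first by rewrite xv1 ltW.
by rewrite divr_ge0 ?(ltW xv_gt0)//= ler_pdivrMr// mul1r lerDl.
Qed.

(* At fixed x + v, limit_poly is a concave quadratic in v, maximal at W u^2 / 2. *)
Lemma limit_poly_bad (sigma alpha x v : R) : 0 < u -> u <= 6^-1 -> 72 * sigma * u ^+ 2 <= 1 ->
  (forall x' v', triangle x' v' -> limit_poly x' v' <= alpha) ->
  triangle x v -> 1 - x - v <= sigma * v ->
  limit_poly x v + 3 / 2 * v * x ^+ 2 <= alpha.
Proof.
move=> u_gt0 u_le su max_alpha [x0 v0 xv1] bad.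
pose Y : R := x + v; pose W : R := 1 - x - v.
have W0 : 0 <= W by rewrite /W; lra.
have Y0 : 0 <= Y by rewrite addr_ge0.
have u2 : 0 < u ^+ 2 by rewrite exprn_gt0.
(* For large Y the origin already does better: the extra term is at most (2/9) Y^3 and the saving in
   the terms with u at most (2/3) Y^3, against a loss of Y^3. *)
have [Yu|Yu] := leP (3 * u) Y.
  apply: le_trans (max_alpha 0 0 _); last by split; lra.
  have amgm : 27 * (v * x ^+ 2) <= 4 * Y ^+ 3.
    rewrite -subr_ge0.
    have -> : 4 * Y ^+ 3 - 27 * (v * x ^+ 2) = (x - 2 * v) ^+ 2 * (4 * x + v).
      by rewrite /Y; ring.
    by rewrite mulr_ge0 ?sqr_ge0//; lra.
  have Y3 : 9 * (u ^+ 2 * Y) <= Y ^+ 3.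
    have -> : 9 * (u ^+ 2 * Y) = (3 * u) ^+ 2 * Y by ring.
    rewrite [leRHS]exprSr; apply: ler_wpM2r => //.
    by rewrite lerXn2r ?nnegrE// mulr_ge0// ltW.
  have W1 : W <= 1 by rewrite /W; lra.
  have h1 : 3 * (u ^+ 2 * (1 - W ^+ 2)) <= 6 * (u ^+ 2 * Y).
    have : 0 <= u ^+ 2 * (Y * (1 - W)) by apply: mulr_ge0; [exact: ltW|apply: mulr_ge0; lra].
    by have -> : W = 1 - Y by [rewrite /W /Y; ring]; lra.
  have h2 : 0 <= u ^+ 4 * (1 - W ^+ 3).
    by rewrite mulr_ge0 ?exprn_ge0 ?(ltW u_gt0)// subr_ge0 exprn_ile1.
  have h3 : 0 <= W ^+ 2 * u ^+ 2 * x by apply: mulr_ge0 => //; exact: mulr_ge0 (sqr_ge0 _) (sqr_ge0 _).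
  have h4 : 0 <= W * v ^+ 2 by rewrite mulr_ge0 ?sqr_ge0.
  have h5 : 0 <= u ^+ 2 * Y by rewrite mulr_ge0 ?(ltW u2).
  rewrite /limit_poly -/W -/Y !subr0 add0r.
  lra.
(* For small Y, v is far above the optimum [v0']. Moving v there gains 3 W (v - v0')^2 >= (3/4) W
   v^2, and W v >= 18 u^2 >= 2 x^2 makes this cover the extra term. *)
pose v0' : R := W * u ^+ 2 / 2.
have W2 : 2^-1 <= W by rewrite /W /Y in Yu *; lra.
have v72 : 72 * u ^+ 2 * W <= v.
  have h : u ^+ 2 * W <= u ^+ 2 * (sigma * v) by rewrite ler_pM2l.
  have := ler_wpM2r v0 su; lra.
have v0'_ge0 : 0 <= v0' by rewrite /v0' divr_ge0 ?mulr_ge0// ltW.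
have v0'_le : 2 * v0' <= v.
  have : 0 <= W * u ^+ 2 by rewrite mulr_ge0// ltW.
  rewrite /v0'; lra.
have := max_alpha (Y - v0') v0'.
have -> : limit_poly (Y - v0') v0' = limit_poly x v + 3 * W * (v - v0') ^+ 2.
  by rewrite /limit_poly /v0' /W /Y; field.
move=> /(_ _)/(le_trans _)-> //; last by split; rewrite /Y; lra.
rewrite lerD2l.
have x9 : x ^+ 2 <= 9 * u ^+ 2.
  have -> : 9 * u ^+ 2 = (3 * u) ^+ 2 by ring.
  have x3u : x <= 3 * u by rewrite (le_trans _ (ltW Yu))// lerDl.
  by rewrite lerXn2r ?nnegrE// (le_trans x0).
have Wv : 18 * u ^+ 2 <= W * v.
  have : 18 * u ^+ 2 <= 72 * u ^+ 2 * W * W.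
    have : 0 <= u ^+ 2 * ((W - 2^-1) * (W + 2^-1)).
      by apply: mulr_ge0; [exact: ltW|apply: mulr_ge0; lra].
    lra.
  by move/le_trans; apply; rewrite mulrC ler_wpM2l.
have : v ^+ 2 <= 4 * (v - v0') ^+ 2.
  have -> : 4 * (v - v0') ^+ 2 = (2 * v - 2 * v0') ^+ 2 by ring.
  by rewrite lerXn2r ?nnegrE//; lra.
move/(ler_wpM2l W0) => h1.
have h2 : v * (2 * x ^+ 2) <= v * (W * v) by apply: ler_wpM2l => //; lra.
lra.
Qed.

(** This provides the positive slope at the maximum. If d v <= W, then v lies below the optimum W
    u^2 / 2 at fixed x + v, because d u^2 > 2, and could be increased with profit. *)
Lemma limit_poly_argmax (d x v : R) : 0 < u -> u <= 6^-1 -> 2 < d * u ^+ 2 ->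
  triangle x v -> (forall x' v', triangle x' v' -> limit_poly x' v' <= limit_poly x v) ->
  0 < x /\ 1 - x - v < d * v.
Proof.
move=> u_gt0 u_le du [x0 v0 xv1] xv_max.
pose W : R := 1 - x - v; have W0 : 0 <= W by rewrite /W; lra.
have u2 : 0 < u ^+ 2 by rewrite exprn_gt0.
have u3 : 0 < u ^+ 3 by rewrite exprn_gt0.
have u4 : 0 < u ^+ 4 by rewrite exprn_gt0.
have x_gt0 : 0 < x.
  rewrite lt_neqAle x0 andbT; apply/eqP => x00.
  (* The test point (u, 0) has value 1 - 3 u^2 + 2 u^3 up to order u^4, while on the side x = 0 the
     value is at most 1 - 3 u^2 + 11 u^4. *)
  have : limit_poly u 0 <= limit_poly x v by apply: xv_max; split; lra.
  rewrite -x00; apply/negP; rewrite -ltNge.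
  apply: (@le_lt_trans _ _ (1 - 3 * u ^+ 2 + 11 * u ^+ 4)).
    have v1 : v <= 1 by lra.
    have := sqr_ge0 (v - 3 * u ^+ 2).
    have h1 : 0 <= v ^+ 2 * (1 - v) by rewrite mulr_ge0 ?sqr_ge0 ?subr_ge0.
    have h2 : 0 <= u ^+ 4 * (1 - (1 - v) ^+ 3).
      by rewrite mulr_ge0 ?(ltW u4)// subr_ge0 exprn_ile1//; lra.
    have h3 : 0 <= u ^+ 2 * v ^+ 2 by rewrite mulr_ge0 ?sqr_ge0.
    by rewrite /limit_poly subr0 add0r; lra.
  have h1 : 0 < u ^+ 3 * (2 - 8 * u - 3 * u ^+ 2) by rewrite mulr_gt0//; nra.
  have h2 : 0 <= u ^+ 4 * (1 - u) ^+ 3 by rewrite mulr_ge0 ?(ltW u4) ?exprn_ge0//; lra.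
  by rewrite /limit_poly subr0 addr0; lra.
split => //.
have W_gt0 : 0 < W.
  rewrite lt_neqAle W0 andbT; apply/eqP => W00.
  have := xv_max 0 0; rewrite /limit_poly -/W -W00 !subr0 addr0.
  have -> : x + v = 1 by rewrite /W in W00; lra.
  have h : triangle 0 0 by split; lra.
  have : u ^+ 2 <= 6^-1 by rewrite expr2; nra.
  by move=> h1 /(_ h); lra.
rewrite -/W ltNge; apply/negP => dv.
(* The cut at x + v keeps the first coordinate of the new point nonnegative. *)
pose v0' : R := W * u ^+ 2 / 2; pose v1 : R := Num.min v0' (x + v).
have vv0 : v < v0'.
  rewrite /v0'.
  have Wu : 0 < W * u ^+ 2 by rewrite mulr_gt0.
  have [v_gt0|v_le0] := ltP 0 v; last by lra.
  have h1 : 2 * v < d * u ^+ 2 * v by rewrite ltr_pM2r.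
  have h2 : d * v * u ^+ 2 <= W * u ^+ 2 by rewrite ler_pM2r.
  lra.
have v1_le : v1 <= v0' by rewrite /v1 ge_min lexx.
have v1_le' : v1 <= x + v by rewrite /v1 ge_min lexx orbT.
have v1_gt : v < v1 by rewrite /v1 lt_min vv0; lra.
have := xv_max (x + v - v1) v1.
have -> : limit_poly (x + v - v1) v1 =
    limit_poly x v + 3 * (W * ((v1 - v) * (W * u ^+ 2 - v1 - v))).
  by rewrite /limit_poly /W; ring.
have : 0 < W * ((v1 - v) * (W * u ^+ 2 - v1 - v)).
  rewrite mulr_gt0// mulr_gt0 ?subr_gt0//.
  have -> : W * u ^+ 2 = 2 * v0' by rewrite /v0'; field.
  lra.
move=> h1 h2; have : triangle (x + v - v1) v1 by split; lra.
by move/h2; lra.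
Qed.

End LimitPolynomial.

(** * The hypergraphs *)

Section TripleGraph.
Variables (V : finType) (r : V -> V -> V -> bool).
Hypothesis r_sym12 : forall a b c, r a b c = r b a c.
Hypothesis r_sym23 : forall a b c, r a b c = r a c b.
Hypothesis r_irr : forall a c, r a a c = false.

Let set3 (t : V * V * V) : {set V} := [set t.1.1; t.1.2; t.2].

Definition triple_edges : {set {set V}} :=
  [set e | [exists t : V * V * V, r t.1.1 t.1.2 t.2 && (e == set3 t)]].

Let r_uniq a b c : r a b c -> [/\ a != b, a != c & b != c].
Proof.
move=> rabc; split; apply/eqP => e; move: rabc; rewrite ?e.
- by rewrite r_irr.
- by rewrite r_sym23 r_irr.
- by rewrite r_sym12 r_sym23 r_irr.
Qed.

Lemma triple_edges_card3 e : e \in triple_edges -> #|e| = 3.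
Proof.
rewrite inE => /existsP[[[a b] c] /andP[/r_uniq[ab ac bc] /eqP ->]].
by rewrite /set3 /= finset.setUC cardsU1 cards2 !inE negb_or ab eq_sym ac eq_sym bc.
Qed.

Definition triple_graph : graph3 := Graph3 triple_edges_card3.

(** The factor 3! counts the orderings of an edge: ordered triples are grouped by their underlying
    set, and each group consists of the six triples in [s]. *)
Lemma lagrangian_poly_triple (R : realType) (y : V -> R) :
  @lagrangian_poly R triple_graph y =
  \sum_a \sum_b \sum_c (r a b c)%:R * (y a * y b * y c).
Proof.
have -> : \sum_a \sum_b \sum_c (r a b c)%:R * (y a * y b * y c) =
    \sum_(t : V * V * V | r t.1.1 t.1.2 t.2) y t.1.1 * y t.1.2 * y t.2.
  rewrite pair_bigA pair_bigA [RHS]big_mkcond; apply: eq_bigr => t _ /=.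
  by case: (r _ _ _); rewrite ?mul1r ?mul0r.
rewrite (partition_big set3 [in triple_edges]) /=; last first.
  by move=> t rt; rewrite inE; apply/existsP; exists t; rewrite rt eqxx.
rewrite /lagrangian_poly mulr_sumr; apply: eq_bigr => e.
rewrite inE => /existsP[[[a b] c] /andP[/= rabc /eqP eE]].
have [ab ac bc] := r_uniq rabc.
pose s := [:: (a, b, c); (a, c, b); (b, a, c); (b, c, a); (c, a, b); (c, b, a)].
have us : uniq s.
  rewrite /= !inE !xpair_eqE /= !(eq_sym b a) !(eq_sym c a) !(eq_sym c b).
  by rewrite (negbTE ab) (negbTE ac) (negbTE bc) !eqxx.
rewrite (eq_bigl [in s]) => [|[[x z] w]].
  have prodE : \prod_(v in e) y v = y a * y b * y c.
    rewrite eE /set3 /= finset.setUC big_setU1 ?big_setU1 ?big_set1 ?inE//=; first by ring.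
    by rewrite negb_or eq_sym ac eq_sym bc.
  rewrite prodE -(big_uniq _ us) /= !big_cons big_nil /=.
  by rewrite (_ : 3`! = 6)//; ring.
rewrite eE; apply/andP/idP => [[rt /eqP st]|].
  have [xz xw zw] := r_uniq rt.
  have : [&& x \in set3 (a, b, c), z \in set3 (a, b, c) & w \in set3 (a, b, c)].
    by rewrite -st !inE /= !eqxx !orbT.
  rewrite !inE -!orbA /=.
  case/and3P => /or3P[] /eqP ex /or3P[] /eqP ez /or3P[] /eqP ew;
    move: xz xw zw; rewrite ex ez ew ?eqxx // => _ _ _;
    by rewrite /s ?inE ?eqxx ?orbT.
have r1 : r a c b by rewrite r_sym23.
have r2 : r b a c by rewrite r_sym12.
have r3 : r b c a by rewrite r_sym23.
have r4 : r c a b by rewrite r_sym12.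
have r5 : r c b a by rewrite r_sym12.
have setE t : (forall v, (v \in set3 t) = [|| v == a, v == b | v == c]) ->
    set3 t == set3 (a, b, c).
  by move=> h; apply/eqP/setP => v; rewrite h !inE /= orbA.
rewrite /s !inE.
case/orP => [/eqP[-> -> ->]|]; first by split.
case/orP => [/eqP[-> -> ->]|].
  by split => //; apply: setE => v; rewrite !inE /= -orbA [X in _ || X]orbC.
case/orP => [/eqP[-> -> ->]|].
  by split => //; apply: setE => v; rewrite !inE /= -orbA orbCA.
case/orP => [/eqP[-> -> ->]|].
  by split => //; apply: setE => v; rewrite !inE /= orbC.
case/orP => [/eqP[-> -> ->]|].
  by split => //; apply: setE => v; rewrite !inE /= -orbA orbC -orbA.
case/eqP => -> -> ->.
by split => //; apply: setE => v; rewrite !inE /= -orbA orbC -orbA orbCA.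
Qed.

End TripleGraph.

Lemma sum3_sumType (R : realType) (A B : finType) (g : A + B -> A + B -> A + B -> R) :
  (forall a b c, g a b c = g b a c) -> (forall a b c, g a b c = g a c b) ->
  \sum_a \sum_b \sum_c g a b c =
    \sum_i \sum_j \sum_k g (inl i) (inl j) (inl k)
    + 3 * (\sum_i \sum_j \sum_p g (inl i) (inl j) (inr p))
    + 3 * (\sum_i \sum_p \sum_q g (inl i) (inr p) (inr q))
    + \sum_p \sum_q \sum_s g (inr p) (inr q) (inr s).
Proof.
move=> g12 g23.
have inner a b : \sum_c g a b c = \sum_k g a b (inl k) + \sum_s g a b (inr s).
  by rewrite big_sumType.
have mid a : \sum_b \sum_c g a b c =
    \sum_j \sum_k g a (inl j) (inl k) + \sum_j \sum_s g a (inl j) (inr s)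
    + (\sum_q \sum_k g a (inr q) (inl k) + \sum_q \sum_s g a (inr q) (inr s)).
  by rewrite big_sumType /= (eq_bigr _ (fun j _ => inner a (inl j)))
    (eq_bigr _ (fun j _ => inner a (inr j))) !big_split.
rewrite big_sumType /= (eq_bigr _ (fun j _ => mid (inl j)))
  (eq_bigr _ (fun j _ => mid (inr j))) !big_split /=.
have -> : \sum_i \sum_q \sum_k g (inl i) (inr q) (inl k) =
    \sum_i \sum_j \sum_p g (inl i) (inl j) (inr p).
  apply: eq_bigr => i _; rewrite exchange_big; apply: eq_bigr => j _.
  by apply: eq_bigr => p _; rewrite g23.
have -> : \sum_p \sum_i \sum_j g (inr p) (inl i) (inl j) =
    \sum_i \sum_j \sum_p g (inl i) (inl j) (inr p).
  rewrite exchange_big; apply: eq_bigr => i _; rewrite exchange_big.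
  by apply: eq_bigr => j _; apply: eq_bigr => p _; rewrite g12 g23.
have -> : \sum_p \sum_i \sum_q g (inr p) (inl i) (inr q) =
    \sum_i \sum_p \sum_q g (inl i) (inr p) (inr q).
  rewrite exchange_big; apply: eq_bigr => i _.
  by apply: eq_bigr => p _; apply: eq_bigr => q _; rewrite g12.
have -> : \sum_p \sum_q \sum_i g (inr p) (inr q) (inl i) =
    \sum_i \sum_p \sum_q g (inl i) (inr p) (inr q).
  under eq_bigr => p _ do rewrite exchange_big.
  rewrite exchange_big; apply: eq_bigr => i _.
  by apply: eq_bigr => p _; apply: eq_bigr => q _; rewrite g23 g12.
by ring.
Qed.

Section DistinctSums.
Variables (R : realType) (I : finType) (y : I -> R).

Lemma sum2_distinct :
  \sum_i \sum_j (i != j)%:R * (y i * y j) = (\sum_i y i) ^+ 2 - \sum_i y i ^+ 2.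
Proof.
rewrite expr2 mulr_suml -sumrB; apply: eq_bigr => i _.
rewrite mulr_sumr (bigD1 i)//= eqxx mul0r add0r [in RHS](bigD1 i)//=.
rewrite expr2 addrC addrK; apply: eq_bigr => j.
by rewrite eq_sym => ->; rewrite mul1r.
Qed.

(** Newton's expression of six times the third elementary symmetric polynomial in power sums. *)
Lemma sum3_distinct :
  \sum_i \sum_j \sum_k [&& i != j, i != k & j != k]%:R * (y i * y j * y k) =
  (\sum_i y i) ^+ 3 - 3 * (\sum_i y i) * (\sum_i y i ^+ 2) + 2 * \sum_i y i ^+ 3.
Proof.
set S1 := \sum_i y i; set S2 := \sum_i y i ^+ 2; set S3 := \sum_i y i ^+ 3.
have inner i j : \sum_k [&& i != j, i != k & j != k]%:R * (y i * y j * y k) =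
    (i != j)%:R * (y i * y j) * S1 - (i != j)%:R * (y i ^+ 2 * y j)
    - (i != j)%:R * (y i * y j ^+ 2).
  have [->|ij] := eqVneq i j; first by rewrite big1 => [|k _] /=; rewrite ?mul0r; ring.
  have -> : S1 = y i + (y j + \sum_(k | (k != i) && (k != j)) y k).
    by rewrite /S1 (bigD1 i)//= (bigD1 j)//= eq_sym.
  have -> : \sum_k [&& true, i != k & j != k]%:R * (y i * y j * y k) =
      y i * y j * \sum_(k | (k != i) && (k != j)) y k.
    rewrite mulr_sumr [RHS]big_mkcond; apply: eq_bigr => k _ /=.
    rewrite (eq_sym i k) (eq_sym j k).
    by case: (_ && _); rewrite ?mul1r ?mul0r.
  by rewrite (_ : (~~ false)%:R = 1 :> R)//; ring.
have A1 : \sum_i \sum_j (i != j)%:R * (y i ^+ 2 * y j) = S2 * S1 - S3.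
  rewrite mulr_suml -sumrB; apply: eq_bigr => i _.
  rewrite mulr_sumr (bigD1 i)//= eqxx mul0r add0r [in RHS](bigD1 i)//=.
  rewrite -exprSr addrC addrK; apply: eq_bigr => j.
  by rewrite eq_sym => ->; rewrite mul1r.
have A2 : \sum_i \sum_j (i != j)%:R * (y i * y j ^+ 2) = S2 * S1 - S3.
  rewrite -A1 exchange_big; apply: eq_bigr => j _; apply: eq_bigr => i _.
  by rewrite eq_sym [y j ^+ 2 * _]mulrC.
under eq_bigr => i _.
  rewrite (eq_bigr _ (fun j _ => inner i j)) !sumrB -mulr_suml.
  over.
rewrite !sumrB -mulr_suml sum2_distinct A1 A2 -/S1 -/S2.
by ring.
Qed.

End DistinctSums.

(** * The hypergraph of an expander and its polynomial *)

Section Construction.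
Variables (m : nat) (T : finType) (E : rel T).
Hypothesis E_sym : symmetric E.
Hypothesis E_irr : irreflexive E.

Notation vertex := (('I_m * bool) + (unit + T))%type.

Definition edge3 (a b c : vertex) : bool :=
  match a, b, c with
  | inl i, inl j, inl k => [&& i != j, i != k & j != k]
  | inl i, inl j, inr (inl _) | inl i, inr (inl _), inl j
  | inr (inl _), inl i, inl j => i != j
  | inl i, inl j, inr (inr _) | inl i, inr (inr _), inl j
  | inr (inr _), inl i, inl j => i.1 != j.1
  | inl _, inr p, inr q | inr p, inl _, inr q | inr p, inr q, inl _ => p != q
  | inr (inl _), inr (inr s), inr (inr t) | inr (inr s), inr (inl _), inr (inr t)
  | inr (inr s), inr (inr t), inr (inl _) => E s t
  | _, _, _ => false
  end.

Lemma edge3_sym12 a b c : edge3 a b c = edge3 b a c.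
Proof.
case: a => [i|[[]|s]]; case: b => [j|[[]|s']]; case: c => [k|[[]|s'']] //=;
  rewrite ?(eq_sym i) ?(eq_sym (i.1)) // ?(E_sym s) //.
- by case: (j == i) => //=; rewrite andbC.
- by rewrite eq_sym.
Qed.

Lemma edge3_sym23 a b c : edge3 a b c = edge3 a c b.
Proof.
case: a => [i|[[]|s]]; case: b => [j|[[]|s']]; case: c => [k|[[]|s'']] //=;
  rewrite ?(eq_sym j) ?(eq_sym (j.1)) // ?(E_sym s') //.
- by rewrite andbCA.
- by rewrite eq_sym.
Qed.

Lemma edge3_irr a c : edge3 a a c = false.
Proof. by case: a => [i|[[]|s]]; case: c => [k|[[]|s'']] //=; rewrite ?eqxx ?E_irr. Qed.

Definition expander_graph3 : graph3 := triple_graph edge3_sym12 edge3_sym23 edge3_irr.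

Lemma expander_graph3_poly (R : realType) (y : vertex -> R) :
  let w i := y (inl i) in
  let v := y (inr (inl tt)) in
  let b t := y (inr (inr t)) in
  let W := \sum_i w i in let x := \sum_t b t in
  @lagrangian_poly R expander_graph3 y =
    W ^+ 3 - 3 * W * (\sum_i w i ^+ 2) + 2 * (\sum_i w i ^+ 3)
    + 3 * v * (W ^+ 2 - \sum_i w i ^+ 2)
    + 3 * x * (W ^+ 2 - \sum_k (w (k, false) + w (k, true)) ^+ 2)
    + 3 * W * ((v + x) ^+ 2 - v ^+ 2 - \sum_t b t ^+ 2)
    + 3 * v * adj_form E b.
Proof.
move=> w v b W x; rewrite lagrangian_poly_triple.
rewrite sum3_sumType => [|a c e|a c e]; first last.
- by rewrite edge3_sym23; ring.
- by rewrite edge3_sym12; ring.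
rewrite [X in _ + X]sum3_sumType => [|a c e|a c e]; first last.
- by rewrite edge3_sym23; ring.
- by rewrite edge3_sym12; ring.
have sum_unit (F : unit -> R) : \sum_i F i = F tt by rewrite (big_pred1 tt) // => -[].
have -> : \sum_i \sum_j \sum_k (edge3 (inl i) (inl j) (inl k))%:R *
    (y (inl i) * y (inl j) * y (inl k)) =
    W ^+ 3 - 3 * W * (\sum_i w i ^+ 2) + 2 * (\sum_i w i ^+ 3).
  exact: (sum3_distinct w).
have -> : \sum_i \sum_j \sum_p (edge3 (inl i) (inl j) (inr p))%:R *
    (y (inl i) * y (inl j) * y (inr p)) =
    v * (W ^+ 2 - \sum_i w i ^+ 2)
    + x * (W ^+ 2 - \sum_k (w (k, false) + w (k, true)) ^+ 2).
  have inner i j : \sum_p (edge3 (inl i) (inl j) (inr p))%:R *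
      (y (inl i) * y (inl j) * y (inr p)) =
      v * ((i != j)%:R * (w i * w j)) + x * ((i.1 != j.1)%:R * (w i * w j)).
    rewrite big_sumType sum_unit /= [x * _]mulr_suml; congr (_ + _).
      by rewrite -/v /w; ring.
    by apply: eq_bigr => t _; rewrite /w /b; ring.
  under eq_bigr => i _.
    rewrite (eq_bigr _ (fun j _ => inner i j)) big_split /= -!mulr_sumr; over.
  rewrite big_split /= -!mulr_sumr (sum2_distinct w); congr (_ + _ * _).
  pose z k := w (k, false) + w (k, true).
  have WE : W = \sum_k z k.
    by rewrite /W sum_pairR; apply: eq_bigr => k _; rewrite big_bool /= [RHS]addrC.
  rewrite WE -(sum2_distinct z) sum_pairR; apply: eq_bigr => k _.
  have sumj i : \sum_(j : 'I_m * bool) ((k, i).1 != j.1)%:R * (w (k, i) * w j) =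
      \sum_j (k != j)%:R * (w (k, i) * z j).
    rewrite sum_pairR; apply: eq_bigr => j _; rewrite big_bool /z /=; ring.
  rewrite big_bool /= !sumj -big_split; apply: eq_bigr => j _ /=.
  by rewrite /z; ring.
have -> : \sum_i \sum_p \sum_q (edge3 (inl i) (inr p) (inr q))%:R *
    (y (inl i) * y (inr p) * y (inr q)) =
    W * ((v + x) ^+ 2 - v ^+ 2 - \sum_t b t ^+ 2).
  have xvE (F : unit + T -> R) : \sum_p F p = F (inl tt) + \sum_t F (inr t).
    by rewrite big_sumType sum_unit.
  have <- : \sum_p \sum_q (p != q)%:R * (y (inr p) * y (inr q)) =
      (v + x) ^+ 2 - v ^+ 2 - \sum_t b t ^+ 2.
    by rewrite (sum2_distinct (fun p => y (inr p))) !xvE -/v opprD addrA.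
  rewrite mulr_suml; apply: eq_bigr => i _; rewrite mulr_sumr.
  apply: eq_bigr => p _; rewrite mulr_sumr; apply: eq_bigr => q _.
  have -> : edge3 (inl i) (inr p) (inr q) = (p != q) by case: p; case: q.
  by rewrite /w; ring.
have z3 (A B C : finType) (F : A -> B -> C -> R) : (forall a b c, F a b c = 0) ->
    \sum_a \sum_b \sum_c F a b c = 0.
  by move=> F0; apply: big1 => a _; apply: big1 => ? _; exact: big1.
rewrite !sum_unit.
rewrite [X in _ + (_ + X)]z3 => [|s t t']; last by rewrite mul0r.
rewrite /= !mul0r [X in 0 + 3 * X + _ + 0]big1 => [|t _]; last by rewrite mul0r.
rewrite /adj_form -/v.
have -> : \sum_t \sum_t' (E t t')%:R * (v * y (inr (inr t)) * y (inr (inr t'))) =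
    v * \sum_t \sum_t' (E t t')%:R * (b t * b t').
  rewrite mulr_sumr; apply: eq_bigr => t _; rewrite mulr_sumr; apply: eq_bigr => t' _.
  by rewrite /b; ring.
ring.
Qed.

End Construction.

(* First a and b are replaced by their mean, then the resulting function of a + b is
   bounded by its tangent at s0. *)
Lemma pair_bound (R : realType) (a b x s0 : R) :
  0 <= a -> 0 <= b -> 0 <= x -> a + b + x <= 1 -> 0 <= s0 <= 1 ->
  - 3 * (a ^+ 2 + b ^+ 2) + 2 * (a ^+ 3 + b ^+ 3) - 6 * x * (a * b) <=
  - (3 / 2) * (1 + x) * s0 ^+ 2 + s0 ^+ 3 / 2
  + (- 3 * (1 + x) * s0 + 3 / 2 * s0 ^+ 2) * (a + b - s0).
Proof.
move=> a0 b0 x0 abx /andP[s00 s01].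
have h1 : 0 <= (a - b) ^+ 2 * (1 - (a + b) - x) by rewrite mulr_ge0 ?sqr_ge0//; lra.
have h2 : 0 <= (a + b - s0) ^+ 2 * (3 / 2 * (1 + x) - (a + b) / 2 - s0).
  by rewrite mulr_ge0 ?sqr_ge0//; lra.
lra.
Qed.

(** * Reduction to uniform weights on each group of vertices *)

Section Bounds.
Variables (R : realType) (m : nat) (T : finType) (E : rel T).
Variables (d : nat) (sigma u : R).
Hypothesis E_exp : expander E d sigma.
Hypothesis m_gt0 : (0 < m)%N.
Hypothesis uE : u ^+ 2 = (2 * m%:R)^-1.

Hypotheses (E_sym : symmetric E) (E_irr : irreflexive E).

Notation G := (expander_graph3 m E_sym E_irr).

Let m0 : m%:R != 0 :> R. Proof. by rewrite pnatr_eq0 -lt0n. Qed.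
Let u4E : u ^+ 4 = (2 * m%:R)^-1 ^+ 2.
Proof. by rewrite -uE -exprM. Qed.

Lemma graph_poly_le (y : vertices G -> R) : simplex y ->
  let v := y (inr (inl tt)) in
  let b t := y (inr (inr t)) in
  let x := \sum_t b t in
  triangle x v /\ lagrangian_poly y <= limit_poly u x v
    + 3 * (v * adj_form E b - (1 - x - v) * \sum_t b t ^+ 2).
Proof.
move=> [y0 y1] v b x; pose w i := y (inl i); pose W := \sum_i w i.
have sumE : W + (v + x) = 1.
  by rewrite -y1 !big_sumType /= (big_pred1 tt)// => -[].
have W0 : 0 <= W by apply: sumr_ge0 => i _; exact: y0.
have x0 : 0 <= x by apply: sumr_ge0 => i _; exact: y0.
have v0 : 0 <= v by exact: y0.
split; first by split => //; lra.
rewrite (expander_graph3_poly _ _ y) -/w -/v -/b -/W -/x.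
pose z k := w (k, false) + w (k, true).
have pairE (F : 'I_m * bool -> R) : \sum_i F i = \sum_k (F (k, false) + F (k, true)).
  by rewrite sum_pairR; apply: eq_bigr => k _; rewrite big_bool /= [RHS]addrC.
pose s0 : R := W / m%:R.
have m1 : 1 <= m%:R :> R by rewrite ler1n.
have s01 : 0 <= s0 <= 1.
  rewrite divr_ge0 ?ler0n//= ler_pdivrMr ?ltr0n// mul1r.
  by apply: le_trans m1; lra.
have key : - 3 * (\sum_i w i ^+ 2) + 2 * (\sum_i w i ^+ 3)
    - 6 * x * (\sum_k w (k, false) * w (k, true)) <=
    - 3 * (1 + x) * W ^+ 2 * u ^+ 2 + 2 * W ^+ 3 * u ^+ 4.
  have WE : \sum_k z k = W by rewrite /W pairE.
  (* All pairs use the tangent at the mean weight [s0] of a pair, so the linear terms cancel in the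
     sum. *)
  have -> : - 3 * (1 + x) * W ^+ 2 * u ^+ 2 + 2 * W ^+ 3 * u ^+ 4 =
      \sum_(k < m) (- (3 / 2) * (1 + x) * s0 ^+ 2 + s0 ^+ 3 / 2
        + (- 3 * (1 + x) * s0 + 3 / 2 * s0 ^+ 2) * (z k - s0)).
    have sum_cst (a : R) : \sum_(k < m) a = m%:R * a.
      by rewrite sumr_const card_ord -[LHS]mulr_natl.
    rewrite big_split /= -mulr_sumr sumrB WE !sum_cst.
    by rewrite uE u4E /s0; field.
  rewrite !pairE 3!mulr_sumr -big_split -sumrB /=; apply: ler_sum => k _.
  apply: pair_bound => //; try exact: y0.
  have : z k <= W.
    by rewrite -WE (bigD1 k)//= lerDl; apply: sumr_ge0 => j _; rewrite addr_ge0 ?y0.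
  rewrite /z; lra.
have sqE : \sum_k (w (k, false) + w (k, true)) ^+ 2 =
    \sum_i w i ^+ 2 + 2 * \sum_k w (k, false) * w (k, true).
  by rewrite pairE mulr_sumr -big_split; apply: eq_bigr => k _ /=; ring.
rewrite sqE /limit_poly.
have WE : W = 1 - x - v by lra.
move: key; rewrite -WE.
move: (\sum_i w i ^+ 2) (\sum_i w i ^+ 3) (\sum_k w (k, false) * w (k, true)).
move: (\sum_t b t ^+ 2) (adj_form E b) => B beta p2 p3 q key.
have -> : 1 - (x + v) ^+ 3 = W ^+ 3 + 3 * W ^+ 2 * (x + v) + 3 * W * (x + v) ^+ 2.
  by rewrite WE; ring.
(* The sum of squares of the w's has total coefficient -3 (W + v + x), which equals the -3 of
   [key]. *)
have p2E : p2 * (W + (v + x)) = p2 by rewrite sumE mulr1.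
lra.
Qed.

Lemma graph_poly_uniform (x v : R) : (0 < #|T|)%N -> triangle x v ->
  exists2 y : vertices G -> R, simplex y & lagrangian_poly y =
    limit_poly u x v + 3 * (d%:R * v - (1 - x - v)) * x ^+ 2 / #|T|%:R.
Proof.
move=> T_gt0 [x0 v0 xv1].
have t0 : #|T|%:R != 0 :> R by rewrite pnatr_eq0 -lt0n.
pose W : R := 1 - x - v; have W0 : 0 <= W by rewrite /W; lra.
pose w : R := W / (2 * m%:R); pose b : R := x / #|T|%:R.
pose y (a : vertices G) : R :=
  match a with inl _ => w | inr (inl _) => v | inr (inr _) => b end.
have sumW a : \sum_(i : 'I_m * bool) a = 2 * m%:R * a :> R.
  by rewrite sumr_const card_prod card_ord card_bool -[LHS]mulr_natl natrM; ring.
have sumT a : \sum_(i : T) a = #|T|%:R * a :> R by rewrite sumr_const -[LHS]mulr_natl.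
have WE : 2 * m%:R * w = W by rewrite /w; field.
have bE : #|T|%:R * b = x by rewrite /b; field.
exists y.
  split=> [[i|[[]|t]]|] //=.
  - by rewrite divr_ge0// mulr_ge0// ler0n.
  - by rewrite divr_ge0// ler0n.
  - rewrite !big_sumType /= (big_pred1 tt) => [|[]//].
    by rewrite sumW sumT WE bE /W; ring.
have sumM a : \sum_(k < m) a = m%:R * a :> R.
  by rewrite sumr_const card_ord -[LHS]mulr_natl.
rewrite (expander_graph3_poly _ _ y) /= !sumW !sumT !sumM WE bE.
have -> : adj_form E (fun=> b) = b ^+ 2 * (d%:R * #|T|%:R).
  have [_ _ <- _ _] := E_exp; rewrite /adj_form mulr_sumr; apply: eq_bigr => t _.
  by rewrite mulr_sumr; apply: eq_bigr => t' _; ring.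
rewrite /limit_poly -/W uE u4E /w /b.
have vE : v = 1 - x - W by rewrite /W; ring.
rewrite vE; field.
by rewrite t0 m0.
Qed.

Lemma lagrangian_ge_uniform (x v : R) : (0 < #|T|)%N -> triangle x v ->
  limit_poly u x v + 3 * (d%:R * v - (1 - x - v)) * x ^+ 2 / #|T|%:R
    <= lagrangian R G.
Proof.
move=> T_gt0 xv; have [y sy <-] := graph_poly_uniform T_gt0 xv.
have : (0 < #|vertices G|)%N by apply/card_gt0P; exists (inr (inl tt)).
by move/(lagrangian_max R) => [z _ [-> zmax]]; exact: zmax.
Qed.

Lemma lagrangian_le_uniform (alpha : R) : 0 < u -> u <= 6^-1 ->
  72 * sigma * u ^+ 2 <= 1 ->
  (forall x v, triangle x v -> limit_poly u x v <= alpha) ->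
  alpha < lagrangian R G ->
  exists x v, triangle x v /\ lagrangian R G <=
    limit_poly u x v + 3 * (d%:R * v - (1 - x - v)) * x ^+ 2 / #|T|%:R.
Proof.
move=> u_gt0 u_le su max_alpha.
have : (0 < #|vertices G|)%N by apply/card_gt0P; exists (inr (inl tt)).
move/(lagrangian_max R) => [y sy [-> _]].
pose v := y (inr (inl tt)); pose b t := y (inr (inr t)); pose x := \sum_t b t.
have [xv yle] : triangle x v /\ lagrangian_poly y <= limit_poly u x v
    + 3 * (v * adj_form E b - (1 - x - v) * \sum_t b t ^+ 2) by exact: graph_poly_le.
move=> alpha_lt; exists x, v; split => //.
have b0 t : 0 <= b t by exact: sy.1.
have v0 : 0 <= v by exact: sy.1.
have [_ _ _ bspec bhalf] := E_exp.
have B0 : 0 <= \sum_t b t ^+ 2 by apply: sumr_ge0 => t _; exact: sqr_ge0.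
(* In the first case the Motzkin-Straus bound and [limit_poly_bad] keep the value at most [alpha], a
   contradiction. In the second, the spectral bound shows that spreading x evenly loses nothing: the
   variance of [b] enters with the coefficient [sigma * v] - W <= 0. *)
have [bad|/ltW good] := leP (1 - x - v) (sigma * v).
  have W0 : 0 <= 1 - x - v by case: xv; lra.
  have h1 := ler_wpM2l v0 (bhalf b b0).
  have h2 : 0 <= (1 - x - v) * \sum_t b t ^+ 2 by exact: mulr_ge0.
  have h3 := limit_poly_bad u_gt0 u_le su max_alpha xv bad.
  by exfalso; rewrite -/x in h1; lra.
apply: (le_trans yle); rewrite lerD2l.
have var : 0 <= \sum_t b t ^+ 2 - x ^+ 2 / #|T|%:R.
  have [T0|T0] := posnP #|T|.
    by rewrite T0 invr0 mulr0 subr0.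
  by rewrite subr_ge0 ler_pdivrMr ?ltr0n// mulrC; exact: sqr_sum_le.
have h1 := ler_wpM2l v0 (bspec b); rewrite -/x in h1.
have h2 : 0 <= (1 - x - v - sigma * v) * (\sum_t b t ^+ 2 - x ^+ 2 / #|T|%:R).
  by rewrite mulr_ge0// subr_ge0.
move: h1 h2; move: (\sum_t b t ^+ 2) (#|T|%:R^-1) (adj_form E b) => B ti beta.
lra.
Qed.

End Bounds.

(* The maximum of h + s g over z is a convex function of s, equal to alpha at
   s = 0 and with positive slope there, hence asymptotically linear. *)
Lemma affine_max_ratio (R : realType) (Z : Type) (h g : Z -> R) (alpha : R)
    (s lam : nat -> R) :
  (forall i, 0 < s i) -> (forall i, s i.+1 < s i) -> s @ \oo --> (0 : R) ->
  (fun i => s i / s i.+1) @ \oo --> (1 : R) ->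
  (forall z, h z <= alpha) -> (exists2 z, h z = alpha & 0 < g z) ->
  (forall i z, h z + s i * g z <= lam i) ->
  (forall i, alpha < lam i -> exists z, lam i <= h z + s i * g z) ->
  [/\ forall i, lam i.+1 < lam i, forall i, alpha < lam i,
      lam @ \oo --> alpha
    & (fun i => (lam i - alpha) / (lam i.+1 - alpha)) @ \oo --> (1 : R)].
Proof.
move=> s_gt0 s_dec s_cvg s_ratio h_le [z0 hz0 gz0] lam_ge lam_le.
have lam_gt i : alpha < lam i.
  by apply: lt_le_trans (lam_ge i z0); rewrite hz0 ltrDl mulr_gt0.
(* [r] is the slope of the chord from 0 to [s i] of a convex function: it decreases along the
   sequence and stays above [g z0], so it has a positive limit and consecutive quotients tend to
   1. *)
pose r i := (lam i - alpha) / s i.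
have rE i : lam i - alpha = r i * s i by rewrite divfK// gt_eqF.
have r_ge i : g z0 <= r i.
  by rewrite ler_pdivlMr// lerBrDl mulrC -hz0.
have r_gt0 i : 0 < r i by exact: lt_le_trans gz0 (r_ge i).
have r_dec i : r i.+1 <= r i.
  (* The maximiser for the smaller parameter is tested at the larger one. *)
  have [z lz] := lam_le i.+1 (lam_gt i.+1).
  have lz' := lam_ge i z; have hz := h_le z.
  rewrite /r ler_pdivrMr//.
  have -> : (lam i - alpha) / s i * s i.+1 = (lam i - alpha) * s i.+1 / s i.
    by rewrite mulrAC.
  rewrite ler_pdivlMr//.
  have := s_gt0 i.+1; have := s_dec i; have := s_gt0 i.
  move: (s i) (s i.+1) lz lz' => a b lz lz' a0 ba b0.
  have h1 : (lam i.+1 - alpha) * a <= (h z + b * g z - alpha) * a.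
    by rewrite ler_pM2r// lerD2r.
  have h2 : (h z + a * g z - alpha) * b <= (lam i - alpha) * b.
    by rewrite ler_pM2r// lerD2r.
  have h3 : 0 <= (alpha - h z) * (a - b) by rewrite mulr_ge0// subr_ge0// ltW.
  lra.
have r_cvg : cvgn r.
  apply: nonincreasing_is_cvgn; first exact/nonincreasing_seqP.
  by exists (g z0) => _ [i _ <-].
have l_gt0 : 0 < limn r.
  by apply: lt_le_trans gz0 _; apply: limr_ge => //; apply: nearW.
split => // [i||].
- rewrite -(ltrD2r (- alpha)) !rE.
  apply: (@le_lt_trans _ _ (r i * s i.+1)); first by rewrite ler_pM2r.
  by rewrite ltr_pM2l.
- have -> : lam = (fun i => alpha + r i * s i).
    by apply/funext => i; rewrite -rE addrC subrK.
  rewrite -[X in _ --> X]addr0 -[X in _ --> (_ + X)](mulr0 (limn r)).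
  by apply: cvgD; [exact: cvg_cst|apply: cvgM].
have -> : (fun i => (lam i - alpha) / (lam i.+1 - alpha)) =
    (fun i => r i * (r i.+1)^-1 * (s i / s i.+1)).
  by apply/funext => i; rewrite !rE; field; rewrite !gt_eqF.
rewrite -[X in _ --> X]mulr1; apply: cvgM => //.
rewrite -[X in _ --> X](divff (lt0r_neq0 l_gt0)).
apply: cvgM => //; apply: cvgV; first exact: lt0r_neq0.
by rewrite (cvg_shiftS r).
Qed.

Theorem theorem3p1 (R : realType) :
  exists (alpha : R) (P : nat -> graph3),
    [/\ forall i : nat, lagrangian R (P i.+1) < lagrangian R (P i),
        forall i : nat, alpha < lagrangian R (P i),
        (fun i : nat => lagrangian R (P i)) @ \oo --> alpha
      & (fun i : nat => (lagrangian R (P i) - alpha)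
                        / (lagrangian R (P i.+1) - alpha)) @ \oo --> (1 : R)].
Proof.
(* With u^2 = 1 / (4 M^2), the two requirements are 18 [sigma] <= M^2 and 8 M^2 < d. An integer M
   with M^2 <= 72 [sigma] exists, and 576 = 8 * 72. *)
have [//|d [sigma [a [T [E [sigma1 sigma_d a_gt0 cardT E_exp]]]]]] :=
  @expander_family R 576.
have E_sym i : symmetric (E i) by case: (E_exp i).
have E_irr i : irreflexive (E i) by case: (E_exp i).
have [M [M_ge M_le]] : exists M : nat,
    18 * sigma <= M%:R ^+ 2 /\ M%:R ^+ 2 <= 72 * sigma.
  pose q := Num.sqrt (18 * sigma).
  have q2 : q ^+ 2 = 18 * sigma by rewrite sqr_sqrtr//; lra.
  have q0 : 0 <= q by exact: sqrtr_ge0.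
  have q1 : 1 <= q by rewrite -[leLHS]sqrtr1 ler_wsqrtr//; lra.
  have /andP[lo hi] := Num.Theory.truncn_itv q0.
  exists (Num.truncn q).+1.
  have n0 : 0 <= (Num.truncn q)%:R :> R by exact: ler0n.
  rewrite -natr1 in hi *; split.
    by rewrite -q2 lerXn2r ?nnegrE ?ltW//; lra.
  have -> : 72 * sigma = (2 * q) ^+ 2 by rewrite exprMn q2; ring.
  by rewrite lerXn2r ?nnegrE//; lra.
have M_gt4 : 4 < (M%:R : R).
  have : (4 : R) ^+ 2 < M%:R ^+ 2 by lra.
  by rewrite ltr_pXn2r// nnegrE.
have M0 : M%:R != 0 :> R by apply: lt0r_neq0; lra.
(* Twice a square, so that 2m = (2M)^2 and u needs no square root. *)
pose m := (2 * M ^ 2)%N; pose u : R := (2 * M%:R)^-1.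
have m_gt0 : (0 < m)%N.
  by rewrite muln_gt0 expn_gt0; case: (M) M0 => //; rewrite eqxx.
have u_gt0 : 0 < u by rewrite invr_gt0; lra.
have u_le : u <= 6^-1 by rewrite lef_pV2 ?posrE; lra.
have uE : u ^+ 2 = (2 * m%:R)^-1.
  by rewrite /u /m natrM natrX; field.
have M2_gt0 : 0 < (M%:R : R) ^+ 2 by lra.
have su : 72 * sigma * u ^+ 2 <= 1.
  have -> : u ^+ 2 = (4 * M%:R ^+ 2)^-1 by rewrite /u; field.
  by rewrite ler_pdivrMr; lra.
have du : 2 < d%:R * u ^+ 2.
  have -> : u ^+ 2 = (4 * M%:R ^+ 2)^-1 by rewrite /u; field.
  by rewrite ltr_pdivlMr; lra.
have [xs [vs [tri_s max_s]]] := limit_poly_max u.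
pose Z := {z : R * R | triangle z.1 z.2}.
pose h (z : Z) := limit_poly u (sval z).1 (sval z).2.
pose g (z : Z) := 3 * (d%:R * (sval z).2 - (1 - (sval z).1 - (sval z).2))
  * (sval z).1 ^+ 2.
pose s i : R := (a%:R)^-1 * harmonic i.+1 ^+ 2.
have a0 : 0 < (a%:R : R)^-1 by rewrite invr_gt0 ltr0n.
have sE i : s i = (#|T i|%:R)^-1.
  by rewrite cardT natrM natrX invfM /s /harmonic exprVn.
have T_gt0 i : (0 < #|T i|)%N by rewrite cardT muln_gt0 a_gt0 expn_gt0.
have harm_cvg : (fun i => harmonic i.+1 : R) @ \oo --> (0 : R).
  by rewrite (cvg_shiftS (@harmonic R : nat -> R)); exact: cvg_harmonic.
exists (limit_poly u xs vs), (fun i => expander_graph3 m (E_sym i) (E_irr i)).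
apply: (@affine_max_ratio R Z h g _ s).
- by move=> i; rewrite sE invr_gt0 ltr0n.
- move=> i; rewrite /s ltr_pM2l// ltr_pXn2r ?nnegrE//= ?invr_ge0 ?ler0n//.
  by rewrite ltf_pV2 ?posrE ?ltr0n// ltr_nat.
- have -> : s = (fun i => (a%:R)^-1 * (harmonic i.+1 * harmonic i.+1)) by [].
  have e : 0 = (a%:R)^-1 * (0 * 0) :> R by rewrite !mulr0.
  by rewrite [X in _ --> X]e; apply: cvgM; [exact: cvg_cst|exact: cvgM].
(* The quotient is ((i + 3) / (i + 2))^2; it tends to 1 because the sizes of the expanders grow only
   polynomially. *)
- have -> : (fun i => s i / s i.+1) = (fun i => (1 + harmonic i.+1) * (1 + harmonic i.+1)).
    apply/funext => i; rewrite /s /harmonic /= -[i.+3%:R]natr1.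
    have : i.+2%:R != 0 :> R by rewrite pnatr_eq0.
    have : i.+2%:R + 1 != 0 :> R by rewrite natr1 pnatr_eq0.
    by move: (i.+2%:R) (a%:R^-1) (lt0r_neq0 a0) => n c c0 n0 n1; field; rewrite n0 c0 n1.
  have e : 1 = (1 + 0) * (1 + 0) :> R by rewrite !addr0 mulr1.
  by rewrite [X in _ --> X]e; apply: cvgM; apply: cvgD => //; exact: cvg_cst.
- by move=> [[x v] xv]; exact: max_s.
- have [x_gt0 v_gt] := limit_poly_argmax u_gt0 u_le du tri_s max_s.
  exists (exist _ (xs, vs) tri_s) => //.
  by rewrite /g /= mulr_gt0 ?exprn_gt0// mulr_gt0// subr_gt0.
- move=> i [[x v] xv]; rewrite /h /g /= mulrC sE.
  exact: (lagrangian_ge_uniform (E_exp i) m_gt0 uE).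
- move=> i lt_i.
  have [x [v [xv le]]] := lagrangian_le_uniform (E_exp i) m_gt0 uE u_gt0 u_le su max_s lt_i.
  by exists (exist _ (x, v) xv); rewrite /h /g /= mulrC sE.
Qed.
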